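(* Assume $(\mathbf H_\Omega)$ and (C1)--(C4) (see context). If $u:\mathbb R^N\times[0,T]\to\mathbb R$ is a bounded viscosity subsolution of $u_t+H(x,t,Du)=0$ in $\mathbb R^N\times(0,T)$ (i.e. $u^*$ satisfies (Sub)), then $u$ is a subsolution of $u_t+\mathbb H^+(x,t,Du)=0$; that is, in addition, $u^*$ satisfies $$w_t+H_T^{\rm reg}(x,t,D_{\mathcal H}w)\le0\quad\text{on }\mathcal H\times(0,T)$$ in the viscosity sense on $\mathcal H$: for every $\phi\in C^1(\mathcal H\times[0,T])$ and every maximum point $(x,t)\in\mathcal H\times(0,T)$ of $u^*|_{\mathcal H\times(0,T)}-\phi$, one has $\phi_t(x,t)+H_T^{\rm reg}(x,t,D_{\mathcal H}\phi(x,t))\le0$.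
   Context: Geometry $(\mathbf H_\Omega)$: $\mathbb R^N=\Omega_1\cup\Omega_2\cup\mathcal H$, where $\Omega_1,\Omega_2$ are disjoint open sets and $\mathcal H=\partial\Omega_1=\partial\Omega_2$ is a $W^{2,\infty}$-hypersurface (the signed distance to $\mathcal H$ is $W^{2,\infty}$ in a neighbourhood of $\mathcal H$). For $z\in\mathcal H$, $\mathbf n_i(z)$ is the unit normal to $\partial\Omega_i$ at $z$ pointing outwards $\Omega_i$. $D_{\mathcal H}$ is the tangential gradient on $\mathcal H$, $T_z\mathcal H$ the tangent space. Control data: $T>0$; for $i=1,2$, $b_i:\overline{\Omega_i}\times[0,T]\times A_i\to\mathbb R^N$, $l_i:\overline{\Omega_i}\times[0,T]\times A_i\to\mathbb R$. (C1) $A_i$ is a compact metric space, $b_i$ is continuous, $|b_i|\le M_b$ and $|b_i(z,s,\alpha_i)-b_i(z',s',\alpha_i)|\le L_b(|z-z'|+|s-s'|)$. (C2) $l_i$ is uniformly continuous, $|l_i|\le M_l$, and $|l_i(z,s,\alpha_i)-l_i(z',s',\alpha_i)|\le m_l(|z-z'|+|s-s'|)$ for a modulus of continuity $m_l$. (C3) For all $z\in\overline{\Omega_i}$, $s\in[0,T]$, the set $\{(b_i(z,s,\alpha_i),l_i(z,s,\alpha_i)):\alpha_i\in A_i\}$ is closed and convex. (C4) There is $\delta>0$ such that for $i=1,2$, $z\in\mathcal H$, $s\in[0,T]$: $\{b_i(z,s,\alpha_i)\cdot\mathbf n_i(z):\alpha_i\in A_i\}\supset[-\delta,\delta]$. Hamiltonians: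 $H_i(x,t,p)=\sup_{\alpha_i\in A_i}\{-b_i(x,t,\alpha_i)\cdot p-l_i(x,t,\alpha_i)\}$ for $x\in\overline{\Omega_i}$. With $A:=A_1\times A_2\times[0,1]$ and $a=(\alpha_1,\alpha_2,\mu)$, for $z\in\mathcal H$: $b_{\mathcal H}(z,s,a)=\mu b_1(z,s,\alpha_1)+(1-\mu)b_2(z,s,\alpha_2)$, $l_{\mathcal H}(z,s,a)=\mu l_1(z,s,\alpha_1)+(1-\mu)l_2(z,s,\alpha_2)$, $A_0^{\rm reg}(z,s)=\{a\in A: b_{\mathcal H}(z,s,a)\cdot\mathbf n_1(z)=0,\ b_i(z,s,\alpha_i)\cdot\mathbf n_i(z)\ge0,\ i=1,2\}$, and for $p\in T_z\mathcal H$, $H_T^{\rm reg}(z,s,p)=\sup_{a\in A_0^{\rm reg}(z,s)}\{-b_{\mathcal H}(z,s,a)\cdot p-l_{\mathcal H}(z,s,a)\}$. $u^*$ is the upper semicontinuous envelope of $u$. (Sub): a bounded usc $w$ satisfies in the viscosity sense $w_t+H_i(x,t,Dw)\le0$ in $\Omega_i\times(0,T)$, $i=1,2$, and $w_t+\min\{H_1(x,t,Dw),H_2(x,t,Dw)\}\le0$ on $\mathcal H\times(0,T)$, the test points being local maxima of $w-\phi$ in $\mathbb R^N\times(0,T)$ with $\phi\in C^1(\mathbb R^N\times(0,T))$. *)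

(* Defs.v *)
From HB Require Import structures.
From mathcomp Require Import all_boot all_order all_algebra.
From mathcomp Require Import all_classical all_reals all_analysis.

Set Implicit Arguments.
Unset Strict Implicit.
Unset Printing Implicit Defensive.

Import Order.TTheory GRing.Theory Num.Theory.
Import numFieldNormedType.Exports.

Local Open Scope classical_set_scope.
Local Open Scope ring_scope.

(** R^N is ['rV[R]_N], whose library norm is the sup norm: [enorm] is the
    Euclidean one.  Functions that the mathematics defines on a subset only are
    total here, and every definition looks at their values on that subset
    alone. *)

Section Euclidean.
Context {R : realType} {N : nat}.
Implicit Types (x y z v n : 'rV[R]_N).

Definition dot x y : R := \sum_i x 0 i * y 0 i.

Definition enorm x : R := Num.sqrt (dot x x).

Definition edist (S : set 'rV[R]_N) x : R := inf [set enorm (x - y) | y in S].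

Definition grad (f : 'rV[R]_N -> R) x : 'rV[R]_N :=
  \row_i 'D_(delta_mx 0 i) f x.

End Euclidean.

(** Class C^1 on an open set [O], for [V] of finite dimension (where pointwise
    convergence of the differentials is convergence in norm). *)
Definition C1_on {R : realType} {V : normedModType R} (O : set V) (f : V -> R) :=
  forall x, O x -> differentiable f x /\
    forall v, 'd f y v @[y --> x] --> ('d f x v : R).

Section Geometry.
Context {R : realType} {N : nat}.
Implicit Types (U O S : set 'rV[R]_N) (x y z v n : 'rV[R]_N).

(** W^{1,oo}(U), for U open, in terms of the continuous representative: bounded
    functions that are Lipschitz, with one constant, along the segments
    contained in U (equivalently, on the balls contained in U).  No Lipschitz
    bound is imposed between points that are far apart inside U. *)
Definition W1inf U (f : 'rV[R]_N -> R) := exists M : R,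
  (forall x, U x -> `|f x| <= M) /\
  (forall x y, (forall r : R, 0 <= r <= 1 -> U (x + r *: (y - x))) ->
     `|f x - f y| <= M * enorm (x - y)).

(** W^{2,oo}(U): f and its first order partial derivatives are in W^{1,oo}(U).
    As the latter are then continuous, they are derivatives in the classical
    sense. *)
Definition W2inf U (f : 'rV[R]_N -> R) :=
  [/\ W1inf U f,
      forall x, U x -> differentiable f x &
      forall i, W1inf U ('D_(delta_mx 0 i) f)].

Definition boundary O := closure O `\` O°.

(** Signed distance to [S]: positive in [O], negative elsewhere. *)
Definition sdist O S x : R :=
  if `[< O x >] then edist S x else - edist S x.

(** Assumption (H_Omega). *)
Definition HOmega O1 O2 S :=
  [/\ open O1 /\ open O2,
      O1 `&` O2 = set0,
      O1 `|` O2 `|` S = setT,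
      S = boundary O1 /\ S = boundary O2 &
      exists U, [/\ open U, S `<=` U & W2inf U (sdist O1 S)]].

(** [g] is a curve on [S] with position [z] and velocity [v] at time 0. *)
Definition curve_on S z v (g : R -> 'rV[R]_N) :=
  [/\ g 0 = z, \forall r \near (0 : R), S (g r) & is_derive (0 : R) (1 : R) g v].

Definition tangent_space S z : set 'rV[R]_N :=
  [set v | exists g, curve_on S z v g].

Definition outward_unit_normal O z n :=
  [/\ enorm n = 1,
      forall v, tangent_space (boundary O) z v -> dot v n = 0 &
      \forall e \near (0 : R)^'+, ~ closure O (z + e *: n)].

End Geometry.

(** Functions of (x, t). *)
Section SpaceTime.
Context {R : realType} {N : nat}.
Local Notation V := 'rV[R]_N.
Implicit Types (S : set V) (z : V * R) (phi w u : V * R -> R).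

Definition closed_cylinder (T : R) : set (V * R) := [set z | 0 <= z.2 <= T].

Definition open_cylinder (T : R) : set (V * R) := [set z | 0 < z.2 < T].

Definition gradx phi z : V := grad (fun x => phi (x, z.2)) z.1.

Definition dt phi z : R := derive1 (fun s : R => phi (z.1, s)) z.2.

(** phi is of class C^1 on the hypersurface S x [0, T]: near each of its points
    it extends to a C^1 function on an open set of R^N x R. *)
Definition C1_on_hypersurface S (T : R) phi :=
  forall z, S z.1 -> closed_cylinder T z ->
  exists (O : set (V * R)) (psi : V * R -> R),
    [/\ open O, O z, C1_on O psi &
        forall y, O y -> S y.1 -> closed_cylinder T y -> phi y = psi y].

(** D_S phi (z): the tangent vector that represents, for the scalar product,
    the derivative of phi(., t) along the curves drawn on S. *)
Definition gradS S phi z : V :=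
  xget 0 [set p | tangent_space S z.1 p /\
    forall v g, curve_on S z.1 v g ->
      is_derive (0 : R) (1 : R) (fun r => phi (g r, z.2)) (dot p v)].

(** Upper semicontinuous envelope, on R^N x [0, T]. *)
Definition usc_env (T : R) u z : R :=
  fine (limf_esup (EFin \o u) (within (closed_cylinder T) (nbhs z))).

Definition bounded_cyl (T : R) w :=
  exists M : R, forall z, closed_cylinder T z -> `|w z| <= M.

Definition usc_cyl (T : R) w := forall z, closed_cylinder T z ->
  forall a : R, w z < a -> \forall y \near within (closed_cylinder T) (nbhs z), w y < a.

End SpaceTime.

Section OneControl.
Context {R : realType} {N : nat} {A : metricType R}.
Local Notation V := 'rV[R]_N.
Variables (O : set V) (T : R) (b : V -> R -> A -> V) (l : V -> R -> A -> R).

Definition modulus_of_continuity (m : R -> R) :=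
  [/\ m 0 = 0, forall r r', 0 <= r -> r <= r' -> m r <= m r' &
      m r @[r --> 0^'+] --> (0 : R)].

Definition hypC1 :=
  [/\ compact [set: A],
      {within [set y : V * R * A | closure O y.1.1 /\ 0 <= y.1.2 <= T],
        continuous (fun y : V * R * A => b y.1.1 y.1.2 y.2)},
      exists Mb : R, forall z s a, closure O z -> 0 <= s <= T ->
        enorm (b z s a) <= Mb &
      exists Lb : R, forall z z' s s' a, closure O z -> closure O z' ->
        0 <= s <= T -> 0 <= s' <= T ->
        enorm (b z s a - b z' s' a) <= Lb * (enorm (z - z') + `|s - s'|)].

Definition hypC2 :=
  [/\ forall e : R, 0 < e -> exists2 d : R, 0 < d &
        forall z z' s s' a a', closure O z -> closure O z' ->
          0 <= s <= T -> 0 <= s' <= T ->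
          enorm (z - z') < d -> `|s - s'| < d -> mdist a a' < d ->
          `|l z s a - l z' s' a'| < e,
      exists Ml : R, forall z s a, closure O z -> 0 <= s <= T ->
        `|l z s a| <= Ml &
      exists2 m, modulus_of_continuity m &
        forall z z' s s' a, closure O z -> closure O z' ->
          0 <= s <= T -> 0 <= s' <= T ->
          `|l z s a - l z' s' a| <= m (enorm (z - z') + `|s - s'|)].

Definition hypC3 := forall z s, closure O z -> 0 <= s <= T ->
  let BL : set (V * R) := [set (b z s a, l z s a) | a in [set: A]] in
  closed BL /\
  forall p q (r : R), BL p -> BL q -> 0 <= r <= 1 -> BL (r *: p + (1 - r) *: q).

(** For z on the hypersurface the set is bounded by (C1), (C2) and nonempty by
    (C4), so that the total function [sup] is the supremum; likewise for [HTreg]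
    below. *)
Definition hamiltonian (z : V * R) (p : V) : R :=
  sup [set - dot (b z.1 z.2 a) p - l z.1 z.2 a | a in [set: A]].

End OneControl.

Section TwoControls.
Context {R : realType} {N : nat} {A1 A2 : metricType R}.
Local Notation V := 'rV[R]_N.
Variables (O1 O2 S : set V) (n1 n2 : V -> V) (T : R).
Variables (b1 : V -> R -> A1 -> V) (l1 : V -> R -> A1 -> R).
Variables (b2 : V -> R -> A2 -> V) (l2 : V -> R -> A2 -> R).
Implicit Types (z : V * R) (w u : V * R -> R).

Definition hypC4 := exists2 delta : R, 0 < delta &
  forall (z : V) (s : R), S z -> 0 <= s <= T -> forall r : R, - delta <= r <= delta ->
    (exists a, dot (b1 z s a) (n1 z) = r) /\
    (exists a, dot (b2 z s a) (n2 z) = r).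

Definition bS z (a : A1 * A2 * R) : V :=
  a.2 *: b1 z.1 z.2 a.1.1 + (1 - a.2) *: b2 z.1 z.2 a.1.2.

Definition lS z (a : A1 * A2 * R) : R :=
  a.2 * l1 z.1 z.2 a.1.1 + (1 - a.2) * l2 z.1 z.2 a.1.2.

Definition A0reg z : set (A1 * A2 * R) :=
  [set a | [/\ 0 <= a.2 <= 1, dot (bS z a) (n1 z.1) = 0,
               0 <= dot (b1 z.1 z.2 a.1.1) (n1 z.1) &
               0 <= dot (b2 z.1 z.2 a.1.2) (n2 z.1)]].

Definition HTreg z (p : V) : R :=
  sup [set - dot (bS z a) p - lS z a | a in A0reg z].

Definition visc_sub w :=
  [/\ bounded_cyl T w, usc_cyl T w &
      forall phi, C1_on (open_cylinder T) phi ->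
      forall z, open_cylinder T z ->
      (\forall y \near z, w y - phi y <= w z - phi z) ->
      [/\ O1 z.1 -> dt phi z + hamiltonian b1 l1 z (gradx phi z) <= 0,
          O2 z.1 -> dt phi z + hamiltonian b2 l2 z (gradx phi z) <= 0 &
          S z.1 -> dt phi z + Num.min (hamiltonian b1 l1 z (gradx phi z))
                                      (hamiltonian b2 l2 z (gradx phi z)) <= 0]].

(** [w_t + H_T^reg(x, t, D_S w) <= 0] on S x (0, T), in the viscosity sense. *)
Definition visc_sub_reg w :=
  forall phi, C1_on_hypersurface S T phi ->
  forall z, S z.1 -> open_cylinder T z ->
  (forall y, S y.1 -> open_cylinder T y -> w y - phi y <= w z - phi z) ->
  dt phi z + HTreg z (gradS S phi z) <= 0.

(** Subsolutions of [u_t + H(x, t, Du) = 0]. *)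
Definition subsolution_H u := visc_sub (usc_env T u).

(** Subsolutions of [u_t + H^+(x, t, Du) = 0]. *)
Definition subsolution_Hplus u := subsolution_H u /\ visc_sub_reg (usc_env T u).

End TwoControls.

(* Main.v *)
(** Let [d] be the signed distance to the hypersurface, positive in [O1], [p] its
    gradient at the contact point, and [f_i] the gap
    [phi_t - b_i . Dphi - l_i] of a control with [b_i . n_i > 0].  At a maximum
    of [w - phi - eta d - |.|^2 - C d^2], [C] large, the drift moves [d] towards
    0, so the penalization has the good sign on each side and vanishes on the
    hypersurface; hence [f_1 + eta beta_1 <= 0] or [f_2 - eta beta_2 <= 0] where
    [beta_1 = - b_1 . p] and [beta_2 = b_2 . p].  The value of [eta] equalizing
    both expressions gives [beta_2 f_1 + beta_1 f_2 <= 0], that is,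
    [mu f_1 + (1 - mu) f_2 <= 0] when the convex combination of the drifts is
    tangential.  Convexity and normal controllability approximate any regular
    control by such strictly outward ones.  The geometry only enters through
    [p <> 0], [n_1 = - k_1 p], [n_2 = k_2 p] with [k_i > 0], and the equality of
    the tangent space, defined by curves, with the orthogonal of [p]. *)

Require Import Defs.
From HB Require Import structures.
From mathcomp Require Import all_boot all_order all_algebra.
From mathcomp Require Import all_classical all_reals all_analysis.
From mathcomp Require Import ring lra.

Set Implicit Arguments.
Unset Strict Implicit.
Unset Printing Implicit Defensive.

Import Order.TTheory GRing.Theory Num.Theory.
Import numFieldNormedType.Exports.

Local Open Scope classical_set_scope.
Local Open Scope ring_scope.

(** * Euclidean structure and functions of class C1 *)

Section Dot.
Context {R : realType} {N : nat}.
Implicit Types (x y z v n : 'rV[R]_N).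

Lemma dotC x y : dot x y = dot y x.
Proof. by apply: eq_bigr => i _; rewrite mulrC. Qed.

Lemma dotDl x y z : dot (x + y) z = dot x z + dot y z.
Proof. by rewrite -big_split; apply: eq_bigr => i _; rewrite !mxE mulrDl. Qed.

Lemma dotZl (k : R) x z : dot (k *: x) z = k * dot x z.
Proof. by rewrite mulr_sumr; apply: eq_bigr => i _; rewrite !mxE mulrA. Qed.

Lemma dotDr x y z : dot z (x + y) = dot z x + dot z y.
Proof. by rewrite dotC dotDl !(dotC _ z). Qed.

Lemma dotZr (k : R) x z : dot z (k *: x) = k * dot z x.
Proof. by rewrite dotC dotZl dotC. Qed.

Lemma dot0l x : dot 0 x = 0.
Proof. by rewrite -(scale0r 0) dotZl mul0r. Qed.

Lemma dotNl x z : dot (- x) z = - dot x z.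
Proof. by rewrite -scaleN1r dotZl mulN1r. Qed.

Lemma dotBl x y z : dot (x - y) z = dot x z - dot y z.
Proof. by rewrite dotDl dotNl. Qed.

Lemma dot_ge0 x : 0 <= dot x x.
Proof. by apply: sumr_ge0 => i _; exact: sqr_ge0. Qed.

Lemma sqr_coord_le_dot x i : x 0 i ^+ 2 <= dot x x.
Proof.
rewrite /dot (bigD1 i)//= expr2 lerDl; apply: sumr_ge0 => j _; exact: sqr_ge0.
Qed.

Lemma dot_eq0 x : dot x x = 0 -> x = 0.
Proof.
move=> x0; apply/rowP => i; rewrite mxE; apply/eqP; rewrite -sqrf_eq0.
by rewrite eq_le sqr_ge0 andbT -x0 sqr_coord_le_dot.
Qed.

Lemma dot_gt0 x : x != 0 -> 0 < dot x x.
Proof.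
move=> x0; rewrite lt_neqAle dot_ge0 andbT eq_sym.
by apply: contra x0 => /eqP/dot_eq0 ->.
Qed.

Lemma enorm_ge0 x : 0 <= enorm x.
Proof. exact: sqrtr_ge0. Qed.

Lemma enorm_sqr x : enorm x ^+ 2 = dot x x.
Proof. by rewrite sqr_sqrtr// dot_ge0. Qed.

Lemma enormN x : enorm (- x) = enorm x.
Proof. by rewrite /enorm dotNl dotC dotNl opprK. Qed.

Lemma coord_le_enorm x i : `|x 0 i| <= enorm x.
Proof. by rewrite -sqrtr_sqr ler_wsqrtr// sqr_coord_le_dot. Qed.

Lemma coord_le_norm x i : `|x 0 i| <= `|x|.
Proof.
rewrite [leRHS]/Num.norm/= mx_normrE.
exact: (le_bigmax _ (fun ij => `|x ij.1 ij.2|) (0, i)).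
Qed.

Lemma norm_le_coord x (M : R) :
  0 <= M -> (forall i, `|x 0 i| <= M) -> `|x| <= M.
Proof.
move=> M0 xM; rewrite [leLHS]/Num.norm/= mx_normrE.
by apply/bigmax_leP; split=> // -[a i] _ /=; rewrite ord1.
Qed.

Lemma norm_le_enorm x : `|x| <= enorm x.
Proof. by apply: norm_le_coord (enorm_ge0 _) _; exact: coord_le_enorm. Qed.

Lemma enorm_le_norm x : enorm x <= N%:R * `|x|.
Proof.
rewrite -(@ler_pXn2r _ 2)// ?nnegrE ?enorm_ge0// ?mulr_ge0// enorm_sqr.
apply: (@le_trans _ _ (\sum_(i < N) `|x| ^+ 2)).
  apply: ler_sum => i _; rewrite -expr2 -[leLHS]real_normK ?num_real//.
  by rewrite ler_pXn2r ?nnegrE// coord_le_norm.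
rewrite sumr_const card_ord -[leLHS]mulr_natl exprMn.
rewrite ler_wpM2r ?sqr_ge0// -natrX ler_nat.
by case: N => // m; rewrite expnS expn1 leq_pmulr.
Qed.

Lemma dot_le_enorm x y : `|dot x y| <= enorm x * \sum_i `|y 0 i|.
Proof.
apply: le_trans (ler_norm_sum _ _ _) _; rewrite mulr_sumr.
by apply: ler_sum => i _; rewrite normrM ler_wpM2r// coord_le_enorm.
Qed.

Lemma dot_orthogonal_complement p n :
  p != 0 -> (forall v, dot v p = 0 -> dot v n = 0) ->
  n = (dot n p / dot p p) *: p.
Proof.
move=> p0 pn; have pp := dot_gt0 p0.
apply/eqP; rewrite -subr_eq0; apply/eqP/dot_eq0.
have orth : dot (n - (dot n p / dot p p) *: p) p = 0.
  by rewrite dotBl dotZl divfK ?subrr// gt_eqF.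
rewrite [X in dot _ X](_ : _ = n + - (dot n p / dot p p) *: p).
  by rewrite dotDr dotZr orth mulr0 addr0 pn.
by rewrite scaleNr.
Qed.

Lemma cvg_dot_coord (T : Type) (F : set_system T) {FF : Filter F}
    (f g : T -> 'rV[R]_N) x y :
  (forall i, f t 0 i @[t --> F] --> x 0 i) ->
  (forall i, g t 0 i @[t --> F] --> y 0 i) ->
  dot (f t) (g t) @[t --> F] --> dot x y.
Proof.
move=> fx gy; apply: cvg_big => [|i _]; first exact: add_continuous.
exact: cvgM.
Qed.

End Dot.

(** * Functions of class C1 at a point, and operations on them *)

Section C1At.
Context {R : realType}.

(** The differential exists near [x] but is continuous at [x] only; being of class C1 around [x] is
    therefore written [\forall y \near x, C1_at f y]. *)
Definition C1_at {V : normedModType R} (f : V -> R) (x : V) :=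
  (\forall y \near x, differentiable f y) /\
  forall v, 'd f y v @[y --> x] --> ('d f x v : R).

Section Generic.
Context {V : normedModType R}.
Implicit Types (f g : V -> R) (x y v : V).

Lemma C1_on_at (O : set V) f x : open O -> O x -> C1_on O f -> C1_at f x.
Proof.
move=> oO Ox fC; split; last by have [] := fC _ Ox.
by apply: filterS (open_nbhs_nbhs (conj oO Ox)) => y /fC[].
Qed.

Lemma C1_at_differentiable f x : C1_at f x -> differentiable f x.
Proof. by move=> [/nbhs_singleton]. Qed.

Lemma C1_at_continuous f x : C1_at f x -> {for x, continuous f}.
Proof. by move=> /C1_at_differentiable/differentiable_continuous. Qed.

(** The first-order expansion, which determines the differential, depends on the germ alone. This
    serves for functions known only near the contact point. *)
Lemma differentiable_near_eq f g x : {near x, f =1 g} ->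
  differentiable f x -> differentiable g x /\ 'd g x = 'd f x :> (V -> R).
Proof.
move=> fg df; have fgx : f x = g x := nbhs_singleton fg.
have g_expand : g \o shift x = cst (g x) + 'd f x +o_ 0 id.
  apply/eqaddoP => _/posnumP[e].
  have /eqaddoP/(_ _ (gt0 e)) fe := diff_locally df.
  have fg0 : \forall h \near (0 : V), f (h + x) = g (h + x).
    by have := fg; rewrite (near_shift 0 x); apply: filterS => h; rewrite /= subr0.
  near=> h.
  have -> : (g \o shift x - (cst (g x) + 'd f x)) h =
            (f \o shift x - (cst (f x) + 'd f x)) h.
    rewrite !fctE /= -fgx; congr (_ - _); apply/esym; near: h; exact: fg0.
  near: h; exact: fe.
have dE := diff_unique (diff_continuous df) g_expand.
split; last exact: dE.
by apply/diff_locallyP; split; rewrite dE; [exact: diff_continuous|].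
Unshelve. all: by end_near. Qed.

Lemma C1_at_near_eq f g x : {near x, f =1 g} -> C1_at f x -> C1_at g x.
Proof.
move=> fg [df dfc]; have fg2 := near_join fg.
have dg : \forall y \near x,
    differentiable g y /\ 'd g y = 'd f y :> (V -> R).
  near=> y; apply: differentiable_near_eq; near: y; first exact: fg2.
  exact: df.
split; first by apply: filterS dg => y [].
move=> v; have [_ ->] := nbhs_singleton dg.
apply: cvg_trans (dfc v); apply: near_eq_cvg.
by apply: filterS dg => y [_ ->].
Unshelve. all: by end_near. Qed.

Lemma diffD_apply f g x v : differentiable f x -> differentiable g x ->
  'd (f + g) x v = 'd f x v + 'd g x v.
Proof. by move=> df dg; exact: (congr1 (fun h => h v) (diffD df dg)). Qed.

Lemma diffZ_apply (k : R) f x v : differentiable f x ->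
  'd (fun y => k * f y) x v = k * 'd f x v.
Proof. by move=> df; exact: (congr1 (fun h => h v) (diffZ k df)). Qed.

Lemma diff_sqr_apply f x v : differentiable f x ->
  'd (fun y => f y ^+ 2) x v = 2 * f x * 'd f x v.
Proof.
move=> df; have -> : (fun y => f y ^+ 2) = f * f.
  by apply/funext => y; rewrite expr2.
have -> : 'd (f * f) x v = f x * 'd f x v + f x * 'd f x v.
  exact: (congr1 (fun h => h v) (diffM df df)).
by ring.
Qed.

Lemma C1_at_cst (c : R) x : C1_at (cst c) x.
Proof.
split; first by near=> y; exact: differentiable_cst.
move=> v; rewrite (_ : (fun y => _) = cst ('d (cst c) x v)); first exact: cvg_cst.
by apply/funext => y; rewrite /= !diff_cst.
Unshelve. all: by end_near. Qed.

Lemma C1_atD f g x : C1_at f x -> C1_at g x -> C1_at (f + g) x.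
Proof.
move=> fC gC; have [df cf] := fC; have [dg cg] := gC.
split; first by near do apply: differentiableD.
move=> v; rewrite diffD; [|exact: C1_at_differentiable..].
apply: cvg_trans (cvgD (cf v) (cg v)).
apply: near_eq_cvg; apply: filterS2 df dg => y fy gy.
by rewrite (diffD fy gy).
Unshelve. all: by end_near. Qed.

Lemma C1_atM f g x : C1_at f x -> C1_at g x -> C1_at (f * g) x.
Proof.
move=> fC gC; have [df cf] := fC; have [dg cg] := gC.
split; first by near do apply: differentiableM.
move=> v; rewrite diffM; [|exact: C1_at_differentiable..].
apply: cvg_trans (cvgD (cvgM (C1_at_continuous fC) (cg v))
  (cvgM (C1_at_continuous gC) (cf v))) => /=.
apply: near_eq_cvg; apply: filterS2 df dg => y fy gy.
by rewrite (diffM fy gy).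
Unshelve. all: by end_near. Qed.

Lemma C1_atZ (k : R) f x : C1_at f x -> C1_at (fun y => k * f y) x.
Proof. by move=> fC; exact: (C1_atM (C1_at_cst k x) fC). Qed.

End Generic.

Lemma C1_at_comp {V : normedModType R} (f : V -> R) (h : R -> R) x :
  C1_at f x -> C1_at h (f x) -> C1_at (h \o f) x.
Proof.
move=> fC hC; have [df cf] := fC; have [dh ch] := hC.
have fc := C1_at_continuous fC.
have dhf : \forall y \near x, differentiable h (f y) by exact: fc dh.
split; first by near do apply: differentiable_comp.
have dE y : differentiable f y -> differentiable h (f y) ->
    forall v, 'd (h \o f) y v = 'd f y v * 'd h (f y) 1.
  move=> fy hy v; rewrite diff_comp//= -[X in 'd h _ X]mulr1.
  by rewrite -[RHS]/('d f y v *: _) -linearZ.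
move=> v; rewrite dE; [|exact: C1_at_differentiable..].
have ch1 : 'd h (f y) 1 @[y --> x] --> ('d h (f x) 1 : R).
  exact: (cvg_comp _ _ fc (ch 1)).
apply: cvg_trans (cvgM (cf v) ch1); apply: near_eq_cvg.
by apply: filterS2 df dhf => y fy hy; rewrite (dE _ fy hy).
Unshelve. all: by end_near. Qed.

Lemma C1_at_comp_linear {U V : normedModType R} (f : V -> R)
    (L : {linear U -> V}) x :
  continuous L -> C1_at f (L x) -> C1_at (f \o L) x.
Proof.
move=> Lc [df cf].
have dL y : differentiable L y by exact: linear_differentiable.
have dfL : \forall y \near x, differentiable f (L y) by exact: Lc df.
split; first by apply: filterS dfL => y; exact: differentiable_comp.
have dE y : differentiable f (L y) ->
    forall v, 'd (f \o L) y v = 'd f (L y) (L v).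
  by move=> fy v; rewrite diff_comp//= diff_lin.
move=> v; rewrite dE; last exact: nbhs_singleton dfL.
apply: cvg_trans (cvg_comp _ _ (Lc x) (cf (L v))).
apply: near_eq_cvg.
by apply: filterS dfL => y fy; rewrite (dE _ fy).
Qed.

Lemma C1_at_linear {V : normedModType R} (L : {linear V -> R}) x :
  continuous L -> C1_at L x.
Proof.
move=> Lc; split; first by near=> y; exact: linear_differentiable.
move=> v; rewrite (_ : (fun y => _) = cst ('d L x v)); first exact: cvg_cst.
by apply/funext => y; rewrite /= !(diff_lin _ Lc).
Unshelve. all: by end_near. Qed.

End C1At.

Section C1More.
Context {R : realType}.

Lemma C1_at_scalar {V : normedModType R} (L : V -> R) x :
  linear L -> continuous L -> C1_at L x.
Proof.
move=> lL Lc; pose mL := GRing.isLinear.Build R V R *:%R L lL.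
pose L' : {linear V -> R} := HB.pack L mL.
exact: (@C1_at_linear _ _ L').
Qed.

Lemma C1_at_sum {V : normedModType R} n (f : 'I_n -> V -> R) x :
  (forall i, C1_at (f i) x) -> C1_at (fun y => \sum_i f i y) x.
Proof.
move=> fC; rewrite (_ : (fun y => _) = \sum_i f i); last first.
  by apply/funext => y; rewrite fct_sumE.
elim/big_ind : _ => [|f1 f2|i _]; [exact: (C1_at_cst 0)|exact: C1_atD|exact: fC].
Qed.

Lemma C1_at_sqr {V : normedModType R} (f : V -> R) x :
  C1_at f x -> C1_at (fun y => f y ^+ 2) x.
Proof.
move=> fC; rewrite (_ : (fun y => _) = f * f); first exact: C1_atM.
by apply/funext => y; rewrite expr2.
Qed.

Lemma is_derive_C1_at (h dh : R -> R) :
  (forall s : R, is_derive s (1 : R) h (dh s)) -> continuous dh ->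
  forall s, C1_at h s.
Proof.
move=> hdh dhc s.
have hd t : differentiable h t by apply/derivable1_diffP; have [] := hdh t.
have dE t v : 'd h t v = v * dh t.
  rewrite -[v in LHS]mulr1 -[v * 1]/(v *: 1) linearZ /= -deriveE//.
  by have [_ ->] := hdh t.
split; first by near=> t; exact: hd.
move=> v; have : (fun y => v * dh y) @ s --> v * dh s.
  by apply: cvgM; [exact: cvg_cst|exact: dhc].
have e : (fun y => 'd h y v) = (fun y => v * dh y).
  by apply/funext => y; exact: dE.
by rewrite -e -(dE s v).
Unshelve. all: by end_near. Qed.

(** The error of the linear approximation is at most [h ^+ 2], by cases on the signs of [s] and
    [h + s]. The squared positive part is the elementary C1 piece from which the cutoff is built. *)
Lemma is_derive_sqr_pos (s : R) :
  is_derive s (1 : R) (fun r : R => Num.max r 0 ^+ 2) (2 * Num.max s 0).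
Proof.
have quad (h : R) : `|Num.max (h + s) 0 ^+ 2 - Num.max s 0 ^+ 2
                 - 2 * Num.max s 0 * h| <= `|h| ^+ 2.
  rewrite real_normK ?num_real//.
  case: (leP (h + s) 0) => hs; case: (leP s 0) => s0; rewrite ler_norml; nra.
have dE : h^-1 *: ((fun r : R => Num.max r 0 ^+ 2) (h *: 1 + s) - Num.max s 0 ^+ 2)
    @[h --> 0^'] --> 2 * Num.max s 0.
  apply/cvgrPdist_le => e e0; near=> h.
  have h0 : h != 0 by near: h; exact: nbhs_dnbhs_neq.
  rewrite /= (_ : h *: 1 = h); last exact: mulr1.
  rewrite distrC.
  have -> : h^-1 *: (Num.max (h + s) 0 ^+ 2 - Num.max s 0 ^+ 2) - 2 * Num.max s 0
      = h^-1 * (Num.max (h + s) 0 ^+ 2 - Num.max s 0 ^+ 2 - 2 * Num.max s 0 * h).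
    by rewrite mulrBr -[h^-1 *: _]/(h^-1 * _) [2 * _ * h]mulrC mulKf.
  rewrite normrM normfV ler_pdivrMl ?normr_gt0//.
  apply: le_trans (quad h) _; rewrite expr2 ler_wpM2l//.
  near: h; apply: dnbhs0_le; exact: e0.
by apply: DeriveDef; [apply/cvg_ex; exists (2 * Num.max s 0)|exact: cvg_lim].
Unshelve. all: by end_near. Qed.

Lemma C1_at_sqr_pos (s : R) : C1_at (fun r : R => Num.max r 0 ^+ 2) s.
Proof.
apply: is_derive_C1_at is_derive_sqr_pos _ s => s.
apply: cvgM; first exact: cvg_cst.
by apply: continuous_max; [exact: cvg_id|exact: cvg_cst].
Qed.

(* A quadratic spline: its second derivative is -4 on ]1, 3/2[ and 4 on
   ]3/2, 2[. *)
Definition bump (s : R) : R :=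
  1 - 2 * Num.max (s - 1) 0 ^+ 2 + 4 * Num.max (s - 3 / 2) 0 ^+ 2
    - 2 * Num.max (s - 2) 0 ^+ 2.

Lemma bump1 s : s <= 1 -> bump s = 1.
Proof.
by move=> s1; rewrite /bump; do 3 (rewrite max_r; last lra); lra.
Qed.

Lemma bump0 s : 2 <= s -> bump s = 0.
Proof.
by move=> s1; rewrite /bump; do 3 (rewrite max_l; last lra); lra.
Qed.

Lemma C1_at_shift_sqr_pos (a s : R) :
  C1_at (fun r : R => Num.max (r - a) 0 ^+ 2) s.
Proof.
apply: (@C1_at_comp _ _ (fun r => r - a) (fun r : R => Num.max r 0 ^+ 2)).
  apply: (@C1_atD _ _ id (cst (- a))); last exact: C1_at_cst.
  by apply: C1_at_scalar => // x; exact: cvg_id.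
exact: C1_at_sqr_pos.
Qed.

Lemma C1_at_bump s : C1_at bump s.
Proof.
have Z k a := C1_atZ k (C1_at_shift_sqr_pos a s).
have := C1_atD (C1_atD (C1_atD (C1_at_cst 1 s) (Z (- 2) 1)) (Z 4 (3 / 2)))
  (Z (- 2) 2).
congr C1_at; apply/funext => r; rewrite /bump /= !fctE /=; ring.
Qed.

End C1More.

(** * Differential calculus in space-time, and localization of test functions *)

Section SpaceTime.
Context {R : realType} {N : nat}.
Local Notation W := ('rV[R]_N * R)%type.
Implicit Types (f G D w : W -> R) (x y z : W).

Lemma pair_decomposition (v : 'rV[R]_N) (s : R) :
  (v, s) = (\sum_i v 0 i *: ((delta_mx 0 i, 0) : W)) + s *: ((0, 1) : W) :> W.
Proof.
rewrite [RHS]surjective_pairing /=; congr pair.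
  rewrite raddf_sum /= scaler0 addr0 {1}(row_sum_delta v).
  by apply: eq_bigr.
rewrite raddf_sum /= big1 => [|i _]; last exact: mulr0.
by rewrite add0r -[RHS]/(s * 1) mulr1.
Qed.

Lemma diff_pairE f z v s :
  'd f z (v, s) = \sum_i v 0 i * 'd f z (delta_mx 0 i, 0) + s * 'd f z (0, 1).
Proof.
rewrite {1}pair_decomposition linearD linearZ linear_sum; congr (_ + _).
by apply: eq_bigr => i _; rewrite linearZ.
Qed.

Lemma derive_fst f z (v : 'rV[R]_N) :
  'D_v (fun a => f (a, z.2)) z.1 = 'D_(v, 0) f z.
Proof.
rewrite /derive.
have -> // : (fun h : R => h^-1 *: (((fun a => f (a, z.2)) \o shift z.1) (h *: v)
    - f (z.1, z.2))) = (fun h => h^-1 *: ((f \o shift z) (h *: (v, 0)) - f z)).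
apply/funext => h; case: z => a b /=; congr (_ *: (f _ - _)).
by rewrite [RHS]surjective_pairing /= scaler0 add0r.
Qed.

Lemma derive_snd f z :
  'D_1 (fun s => f (z.1, s)) z.2 = 'D_(0, 1) f z.
Proof.
rewrite /derive.
have -> // : (fun h : R => h^-1 *: (((fun s => f (z.1, s)) \o shift z.2) (h *: 1)
    - f (z.1, z.2))) = (fun h => h^-1 *: ((f \o shift z) (h *: (0, 1)) - f z)).
apply/funext => h; case: z => a b /=; congr (_ *: (f _ - _)).
by rewrite [RHS]surjective_pairing /= scaler0 add0r.
Qed.

Lemma diff_gradx_dt f z v s : differentiable f z ->
  'd f z (v, s) = dot v (gradx f z) + s * dt f z.
Proof.
move=> df; rewrite diff_pairE; congr (_ + _ * _).
  apply: eq_bigr => i _; congr (_ * _).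
  by rewrite mxE derive_fst deriveE.
by rewrite /dt derive1E derive_snd deriveE.
Qed.

(** [C1_at] gives convergence in a fixed direction. Expanding the direction on the finite basis lets
    it move with the point, as the drift does. *)
Lemma cvg_diff (I : Type) (F : set_system I) {FF : Filter F} f z
    (y : I -> W) (v : I -> 'rV[R]_N) v0 s :
  C1_at f z -> y @ F --> z -> v @ F --> v0 ->
  'd f (y t) (v t, s) @[t --> F] --> ('d f z (v0, s) : R).
Proof.
move=> [_ fC] yz vv0.
have dc u : 'd f (y t) u @[t --> F] --> ('d f z u : R).
  exact: (cvg_comp _ _ yz (fC u)).
have : (fun t => \sum_i v t 0 i * 'd f (y t) (delta_mx 0 i, 0)
      + s * 'd f (y t) (0, 1)) @ F -->
    \sum_i v0 0 i * 'd f z (delta_mx 0 i, 0) + s * 'd f z (0, 1).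
  apply: cvgD; last by apply: cvgM (dc _); exact: cvg_cst.
  apply: cvg_big => [|i _]; first exact: add_continuous.
  apply: cvgM (dc _).
  exact: (cvg_comp _ _ vv0 (@coord_continuous _ _ _ 0 i v0)).
have e : (fun t => 'd f (y t) (v t, s)) = (fun t =>
    \sum_i v t 0 i * 'd f (y t) (delta_mx 0 i, 0) + s * 'd f (y t) (0, 1)).
  by apply/funext => t; exact: diff_pairE.
by rewrite -e -(diff_pairE f z v0 s).
Qed.

Definition qdist z y : R := dot (y.1 - z.1) (y.1 - z.1) + (y.2 - z.2) ^+ 2.

Lemma qdistzz z : qdist z z = 0.
Proof. by rewrite /qdist !subrr dot0l expr2 mulr0 addr0. Qed.

Lemma qdist_gt0 z y : y != z -> 0 < qdist z y.
Proof.
move=> yz; rewrite lt_neqAle addr_ge0 ?dot_ge0 ?sqr_ge0// andbT eq_sym.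
apply: contra yz; rewrite paddr_eq0 ?dot_ge0 ?sqr_ge0// sqrf_eq0 subr_eq0.
case/andP => /eqP/dot_eq0/eqP; rewrite subr_eq0 => /eqP e1 /eqP e2.
by apply/eqP; case: y e1 e2 => a b /= -> ->; case: z.
Qed.

Lemma norm_le_qdist z y : `|y - z| ^+ 2 <= qdist z y.
Proof.
have h : `|y - z| = Num.max `|y.1 - z.1| `|y.2 - z.2| by [].
rewrite h /qdist -enorm_sqr; case: (leP `|y.1 - z.1|) => _.
  by rewrite real_normK ?num_real//= lerDr sqr_ge0.
apply: (@le_trans _ _ (enorm (y.1 - z.1) ^+ 2)); last by rewrite lerDl sqr_ge0.
by rewrite ler_pXn2r ?nnegrE ?enorm_ge0// norm_le_enorm.
Qed.

Lemma C1_at_coord (i : 'I_N) (c : R) y : C1_at (fun y : W => y.1 0 i - c) y.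
Proof.
apply: (@C1_atD _ _ (fun y : W => y.1 0 i) (cst (- c))); last exact: C1_at_cst.
apply: C1_at_scalar => [k a b|x]; first by rewrite !mxE.
apply: (@continuous_comp _ _ _ (@fst 'rV[R]_N R) (fun u : 'rV[R]_N => u 0 i)).
  exact: cvg_fst.
exact: coord_continuous.
Qed.

Lemma C1_at_qdist z y : C1_at (qdist z) y.
Proof.
rewrite (_ : qdist z = (fun y : W => \sum_i (y.1 0 i - z.1 0 i) ^+ 2) +
   (fun y => (y.2 - z.2) ^+ 2)).
  apply: C1_atD; first by apply: C1_at_sum => i; exact/C1_at_sqr/C1_at_coord.
  apply: C1_at_sqr.
  apply: (@C1_atD _ _ (fun y : W => y.2) (cst (- z.2))); last exact: C1_at_cst.
  apply: C1_at_scalar => // x; exact: cvg_snd.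
apply/funext => x; rewrite /qdist fctE; congr (_ + _).
by apply: eq_bigr => i _; rewrite !mxE expr2.
Qed.

Lemma diff_qdist z v : 'd (qdist z) z v = 0.
Proof.
rewrite -deriveE; last exact: C1_at_differentiable (C1_at_qdist z z).
apply: cvg_lim => //.
(* [qdist z] is quadratic in the displacement, so the difference quotient is of order [h]. *)
rewrite (_ : (fun h => _) = fun h : R => h^-1 * (h ^+ 2 * qdist 0 v)); last first.
  apply/funext => h; rewrite qdistzz subr0 -[LHS]/(_ * _); congr (_ * _).
  by rewrite /qdist /= !addrK !subr0 dotZl dotZr -[_ *: _]/(_ * _); ring.
apply/cvgrPdist_lt => e e0.
have e1 : 0 < e / (1 + `|qdist 0 v|) by rewrite divr_gt0// ltr_pwDl.
near=> h.
have h0 : h != 0 by near: h; exact: nbhs_dnbhs_neq.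
rewrite sub0r normrN mulrA expr2 mulrA mulVf// mul1r normrM.
apply: (@le_lt_trans _ _ (`|h| * (1 + `|qdist 0 v|))).
  by rewrite ler_wpM2l// lerDr.
rewrite -ltr_pdivlMr ?ltr_pwDl//; near: h; exact: dnbhs0_lt.
Unshelve. all: by end_near. Qed.

(** Viscosity test functions must be C1 on the whole cylinder, whereas the signed distance is so
    only near the hypersurface. Multiplying by a bump function extends the germ by zero. *)
Lemma C1_cutoff f z : (\forall y \near z, C1_at f y) ->
  exists g, (forall y, C1_at g y) /\ \forall y \near z, g y = f y.
Proof.
move=> /nbhs_ballP[e /= e0 fC].
(* The cutoff vanishes once [qdist z y] reaches [2 * rho], which is less than [e ^+ 2]; its support
   thus stays in the ball where [f] is C1. *)
pose rho := e ^+ 2 / 4.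
have rho0 : 0 < rho by rewrite divr_gt0// exprn_gt0.
pose chi := bump \o (fun y => rho^-1 * qdist z y).
have chiC y : C1_at chi y.
  apply: C1_at_comp; last exact: C1_at_bump.
  exact/C1_atZ/C1_at_qdist.
exists (chi * f); split=> [y|].
  have [small|large] := leP (qdist z y) (2 * rho).
    apply: C1_atM => //; apply: fC; rewrite -ball_normE /= distrC.
    rewrite -(@ltr_pXn2r _ 2)// ?nnegrE ?(ltW e0)//.
    apply: le_lt_trans (norm_le_qdist z y) _; apply: le_lt_trans small _.
    by have := exprn_gt0 2 e0; rewrite /rho; lra.
  apply: (C1_at_near_eq _ (C1_at_cst 0 y)).
  have : \forall x \near y, 2 * rho < qdist z x.
    exact: (cvgr_gt _ (C1_at_continuous (C1_at_qdist z y)) _ large).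
  apply: filterS => x xl; rewrite /= fctE /chi /= bump0 ?mul0r//.
  by rewrite ler_pdivlMl// mulrC ltW.
have : \forall y \near z, qdist z y < rho.
  apply: (cvgr_lt _ (C1_at_continuous (C1_at_qdist z z))).
  by rewrite qdistzz.
apply: filterS => y yl; rewrite fctE /chi /= bump1 ?mul1r//.
by rewrite ler_pdivrMl// mulr1 ltW.
Qed.

End SpaceTime.

(** * Penalization *)

Section Penalization.
Context {R : realType}.

Lemma near_pinfty_ex_ge0 (P : set R) :
  (\forall a \near +oo, P a) -> exists2 a, 0 <= a & P a.
Proof.
move=> [M [_ MP]]; exists (Num.max 0 (M + 1)); first by rewrite le_max lexx.
by apply: MP; rewrite lt_max ltrDl ltr01 orbT.
Qed.

Definition usc_at {X : topologicalType} (f : X -> R) x :=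
  forall a, f x < a -> \forall y \near x, f y < a.

Lemma usc_atB {X : topologicalType} (f g : X -> R) x :
  usc_at f x -> {for x, continuous g} -> usc_at (fun y => f y - g y) x.
Proof.
move=> fx gx a fga; pose e := (a - (f x - g x)) / 2.
have e0 : 0 < e by rewrite /e; lra.
have fe : \forall y \near x, f y < f x + e by apply: fx; rewrite ltrDl.
have ge : \forall y \near x, g x - e < g y.
  by apply: (cvgr_gt _ gx); rewrite ltrBlDr ltrDl.
apply: filterS2 fe ge => y; rewrite /e; lra.
Qed.

(** A first covering argument bounds [f] above, so that [sup] is meaningful. If the supremum [M]
    were not attained, the midpoints of [f x] and [M] would give, by a second one, a bound [b < M]
    valid on all of [K]. *)
Lemma usc_compact_max {X : topologicalType} (f : X -> R) (K : set X) :
  compact K -> K !=set0 -> (forall x, K x -> usc_at f x) ->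
  exists2 x, K x & forall y, K y -> f y <= f x.
Proof.
move=> /compact_near_coveringP cK [x0 Kx0] fK; apply: contrapT => nomax.
have bounded : \forall a \near +oo, K `<=` (fun y => f y < a).
  apply: (cK R +oo (fun a y => f y < a)) => x Kx.
  have fx : \forall y \near x, f y < f x + 1 by apply: fK; rewrite ?ltrDl.
  near=> y a => /=; apply: (@lt_trans _ _ (f x + 1)); first by near: y.
  near: a; apply: nbhs_pinfty_gt; exact: num_real.
have [a aK] : exists a, K `<=` (fun y => f y < a).
  by have [a _ aK] := near_pinfty_ex_ge0 bounded; exists a.
pose M := sup (f @` K).
have fM y : K y -> f y <= M.
  move=> Ky; apply: ub_le_sup; last by exists y.
  by exists a => _ [t Kt <-]; exact/ltW/aK.
have fltM x : K x -> f x < M.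
  move=> Kx; rewrite lt_neqAle fM// andbT; apply/eqP => fxM; apply: nomax.
  by exists x => // y Ky; rewrite fxM fM.
have [b bM bK] : exists2 b, b < M & K `<=` (fun y => f y < b).
  have : \forall b \near M^'-, K `<=` (fun y => f y < b).
    apply: (cK R M^'- (fun b y => f y < b)) => x Kx.
    have [fx xM] := midf_lt (fltM _ Kx).
    have fxm := fK _ Kx _ fx.
    near=> y b => /=; apply: (@lt_trans _ _ ((f x + M) / 2)).
      by near: y.
    by near: b; exact: nbhs_left_gt.
  move=> nb; have : \forall b \near M^'-, b < M /\ K `<=` (fun y => f y < b).
    by apply: filterS2 nb (nbhs_left_lt M) => b; split.
  by move=> /filter_ex[b []]; exists b.
have : M <= b.
  apply: ge_sup; first by exists (f x0), x0.
  by move=> _ [y Ky <-]; exact/ltW/bK.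
by rewrite leNgt bM.
Unshelve. all: by end_near. Qed.

Context {N : nat}.
Local Notation W := ('rV[R]_N * R)%type.

Lemma closed_ball_compact (z : W) (r : R) : 0 < r -> compact (closed_ball z r).
Proof.
move=> r0; apply: (@subclosed_compact _ _
  (closed_ball z.1 r `*` closed_ball z.2 r)).
- exact: closed_ball_closed.
- apply: compact_setX; last exact: closed_ballR_compact.
  apply: bounded_closed_compact; last exact: closed_ball_closed.
  rewrite closed_ballE//; exists (`|z.1| + r); split; first exact: num_real.
  move=> M zM y; rewrite /closed_ball_ /= => zy.
  rewrite -[y](subrKC z.1); apply: le_trans (ler_normD _ _) _.
  by rewrite distrC in zy; apply: le_trans (ltW zM); rewrite lerD2l.
- rewrite !closed_ballE// => y; rewrite /closed_ball_ /=.
  by rewrite [`|z - y|]/(Num.max _ _) ge_max => /andP[].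
Qed.

(* On a small sphere around [z0], [f - qdist z0 - C D^2] is less than its value
   at [z0]: where [D = 0] because of [qdist], elsewhere for [C] large.  The
   maximum on the ball is then an interior point. *)
Lemma penalized_max (f D : W -> R) (z0 : W) (P : set W) :
  (\forall y \near z0, usc_at f y) ->
  (\forall y \near z0, {for y, continuous D}) ->
  D z0 = 0 -> (\forall y \near z0, D y = 0 -> f y <= f z0) ->
  nbhs z0 P ->
  exists z C, [/\ P z, 0 <= C & \forall y \near z,
    f y - (qdist z0 y + C * D y ^+ 2) <= f z - (qdist z0 z + C * D z ^+ 2)].
Proof.
move=> fU Dc D0 fD0 nP.
have [r r0 Kgood] : exists2 r : R, 0 < r & closed_ball z0 r `<=`
    (fun y => usc_at f y /\ {for y, continuous D}) `&`
    (fun y => (D y = 0 -> f y <= f z0) /\ P y).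
  have [r ?] := (nbhs_closedballP _ _).1
    (filterI (filterI fU Dc) (filterI fD0 nP)).
  by exists r%:num.
set K := closed_ball z0 r in Kgood.
have qc y : {for y, continuous (qdist z0)}.
  exact: C1_at_continuous (C1_at_qdist z0 y).
have fqU y : K y -> usc_at (fun y => f y - qdist z0 y) y.
  by move=> /Kgood[[fy _] _]; exact: usc_atB.
have cK : compact K by exact: closed_ball_compact.
have cB : compact (K `&` ~` ball z0 r).
  apply: subclosed_compact cK _ => [|y []//].
  apply: closedI; first exact: closed_ball_closed.
  by apply: open_closedC; apply: ball_open.
have D2c y : K y -> {for y, continuous (fun y => D y ^+ 2)}.
  move=> /Kgood[[_ Dy] _]; apply: (@continuous_comp _ _ _ D (fun r => r ^+ 2)) => //.
  exact: exprn_continuous.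
have [C C0 sphere] : exists2 C, 0 <= C & forall y, (K `&` ~` ball z0 r) y ->
    f y - qdist z0 y - C * D y ^+ 2 < f z0.
  have : \forall C \near +oo, (K `&` ~` ball z0 r) `<=`
      (fun y => f y - qdist z0 y - C * D y ^+ 2 < f z0).
    move: cB => /compact_near_coveringP cB.
    apply: (cB R +oo (fun C y => f y - qdist z0 y - C * D y ^+ 2 < f z0)).
    move=> y [Ky yz].
    have qy : 0 < qdist z0 y.
      by apply: qdist_gt0; apply/eqP => yz0; apply: yz; rewrite yz0; exact: ballxx.
    have [Dy|Dy] := eqVneq (D y) 0.
      have fy : \forall y' \near y, f y' - qdist z0 y' < f z0.
        apply: fqU => //; have [_ [/(_ Dy) + _]] := Kgood _ Ky; lra.
      near=> y' C => /=; have Cge0 : 0 <= C by near: C; apply: nbhs_pinfty_ge; exact: num_real.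
      have : f y' - qdist z0 y' < f z0 by near: y'.
      by have := mulr_ge0 Cge0 (sqr_ge0 (D y')); lra.
    (* Half of [D y ^+ 2] remains a lower bound nearby, so a [C] chosen from the values at [y] works
       on a neighbourhood. *)
    pose c := D y ^+ 2 / 2.
    have c0 : 0 < c by rewrite /c divr_gt0// exprn_even_gt0.
    have fy : \forall y' \near y, f y' - qdist z0 y' < f y - qdist z0 y + 1.
      by apply: fqU => //; rewrite ltrDl.
    have Dy2 : \forall y' \near y, c < D y' ^+ 2.
      by apply: (cvgr_gt _ (D2c _ Ky)); rewrite /c; move: c0; rewrite /c; lra.
    near=> y' C => /=.
    have Cge0 : 0 <= C by near: C; apply: nbhs_pinfty_ge; exact: num_real.
    have Cbig : (f y - qdist z0 y + 1 - f z0) / c <= C.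
      by near: C; apply: nbhs_pinfty_ge; exact: num_real.
    rewrite ler_pdivrMr// in Cbig.
    have : f y' - qdist z0 y' < f y - qdist z0 y + 1 by near: y'.
    have : c < D y' ^+ 2 by near: y'.
    by move=> /ltW/(ler_wpM2l Cge0); lra.
  by move=> /near_pinfty_ex_ge0[C C0 sphere]; exists C.
have Kz0 : K z0 by apply: closed_ballxx.
have [z Kz zmax] : exists2 z, K z & forall y, K y ->
    f y - qdist z0 y - C * D y ^+ 2 <= f z - qdist z0 z - C * D z ^+ 2.
  apply: usc_compact_max => //; first by exists z0.
  move=> y Ky; apply: usc_atB; first exact: fqU.
  by apply: cvgM; [exact: cvg_cst|exact: D2c].
exists z, C; split => //; first by have [_ []] := Kgood _ Kz.
have zball : ball z0 r z.
  apply: contrapT => nz; have := sphere _ (conj Kz nz).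
  by have := zmax _ Kz0; rewrite qdistzz D0 expr2 !mulr0 !subr0; lra.
have : \forall y \near z, ball z0 r y.
  by apply: open_nbhs_nbhs; split => //; apply: ball_open.
apply: filterS => y /subset_closure /zmax; lra.
Unshelve. all: by end_near. Qed.

End Penalization.

(** * Distance functions *)

Section Calculus.
Context {R : realType} {V : normedModType R}.
Implicit Types (f : V -> R) (x y z v : V).

Lemma diff_approx f z (e : R) : differentiable f z -> 0 < e ->
  \forall h \near (0 : V), `|f (h + z) - f z - 'd f z h| <= e * `|h|.
Proof.
move=> df e0; have /eqaddoP/(_ _ e0) := diff_locally df.
apply: filterS => h; rewrite !fctE /=; apply: le_trans.
by rewrite opprD addrA.
Qed.

Lemma is_derive_comp_curve f (g : R -> V) (t : R) v :
  differentiable f (g t) -> is_derive t (1 : R) g v ->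
  is_derive t (1 : R) (fun r => f (g r)) ('d f (g t) v).
Proof.
move=> df [dg gv]; have dg' : differentiable g t by apply/derivable1_diffP.
have dfg : differentiable (f \o g) t by exact: differentiable_comp.
apply: DeriveDef; first exact/derivable1_diffP.
by rewrite [LHS](deriveE _ dfg) diff_comp//= -(deriveE _ dg') gv.
Qed.

Lemma ball_segment z (r : R) x y (t : R) : ball z r x -> ball z r y ->
  0 <= t <= 1 -> ball z r (y + t *: (x - y)).
Proof.
rewrite -!ball_normE /= => zx zy /andP[t0 t1].
rewrite (_ : z - _ = (1 - t) *: (z - y) + t *: (z - x)); last first.
  rewrite opprD addrA scalerBl scale1r -[RHS]addrA; congr (_ + _).
  rewrite [RHS]addrC -scalerBr -scalerN; congr (_ *: _).
  by rewrite !opprB [RHS]addrC subrKA.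
apply: le_lt_trans (ler_normD _ _) _; rewrite !normrZ !ger0_norm ?subr_ge0//.
have [t1'|t1'] := ltP t 1; last by rewrite (_ : t = 1); lra.
have := ler_wpM2l t0 (ltW zx).
have : 0 < (1 - t) * (r - `|z - y|) by apply: mulr_gt0; rewrite subr_gt0.
lra.
Qed.

Lemma mean_value_ball f z (r : R) x y :
  (forall u, ball z r u -> differentiable f u) -> ball z r x -> ball z r y ->
  exists2 u, ball z r u & f x - f y = 'd f u (x - y).
Proof.
move=> df zx zy; pose g (t : R) := y + t *: (x - y).
have gball t : 0 <= t <= 1 -> ball z r (g t) by exact: ball_segment.
have dg (t : R) : is_derive t (1 : R) g (x - y).
  have h : is_derive t (1 : R) (fun s : R => s *: (x - y)) (x - y).
    have dlin : differentiable (fun s : R => s *: (x - y)) t by [].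
    apply: DeriveDef; first exact/derivable1_diffP.
    by rewrite (deriveE _ dlin) diff_val scale1r.
  by apply: is_derive_eq; rewrite add0r.
have dfg (t : R) : 0 <= t <= 1 ->
    is_derive t (1 : R) (fun s => f (g s)) ('d f (g t) (x - y)).
  by move=> /gball /df ?; exact: is_derive_comp_curve.
have [t t01||c c01] := MVT_segment (ler01 : (0 : R) <= 1)
    (f := fun s => f (g s)) (df := fun s => 'd f (g s) (x - y)).
- move: t01; rewrite in_itv/= => /andP[/ltW t0 /ltW t1].
  by apply: dfg; rewrite t0.
- apply: derivable_within_continuous => t; rewrite in_itv/= => t01.
  by have [] := dfg t t01.
rewrite subr0 mulr1 /g scale1r scale0r addr0 subrKC => e.
by exists (g c); [apply: gball; move: c01; rewrite in_itv|].
Qed.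

End Calculus.

Section Distance.
Context {R : realType} {N : nat}.
Local Notation V := 'rV[R]_N.
Implicit Types (x y z v n p : V) (O S : set V) (d : V -> R).

Lemma diff_grad d x v : differentiable d x -> 'd d x v = dot v (grad d x).
Proof.
move=> dd; rewrite [v in LHS]row_sum_delta linear_sum.
by apply: eq_bigr => i _; rewrite linearZ mxE deriveE.
Qed.

Lemma W1inf_continuous U d x : open U -> U x -> W1inf U d -> {for x, continuous d}.
Proof.
move=> oU Ux [M [_ dL]]; have M0 : 0 <= Num.max M 0 by rewrite le_max lexx orbT.
have /nbhs_ballP[r /= r0 rU] := open_nbhs_nbhs (conj oU Ux).
(* The maximum with 0 is there because [M] has no prescribed sign, the factor [N] compares the two
   norms, and adding 1 permits division. *)
have K0 : 0 < Num.max M 0 * N%:R + 1.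
  by rewrite ltr_wpDl// mulr_ge0.
apply: (iffRL (@cvgrPdist_lt _ _ _ (nbhs x) (nbhs_filter x) d (d x))) => e e0.
have eK : 0 < e / (Num.max M 0 * N%:R + 1) by exact: divr_gt0.
have nr : \forall y \near x, ball x r y by exact: nbhsx_ballx.
have ne : \forall y \near x, ball x (e / (Num.max M 0 * N%:R + 1)) y.
  exact: nbhsx_ballx.
apply: filterS2 nr ne => y xyr; rewrite -ball_normE /= => xye.
apply: (@le_lt_trans _ _ (M * enorm (x - y))).
  apply: dL => t t01; apply: rU; apply: ball_segment => //; exact: ballxx.
apply: (@le_lt_trans _ _ ((Num.max M 0 * N%:R + 1) * `|x - y|)).
  rewrite mulrDl mul1r -mulrA ler_wpDr//.
  apply: (@le_trans _ _ (Num.max M 0 * enorm (x - y))).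
    by rewrite ler_wpM2r ?enorm_ge0// le_max lexx.
  by rewrite ler_wpM2l// enorm_le_norm.
by rewrite mulrC -ltr_pdivlMr.
Qed.

(** The partial derivatives are locally Lipschitz, hence continuous, and the differential is the
    scalar product with the gradient. *)
Lemma W2inf_C1_at U d x : open U -> U x -> W2inf U d -> C1_at d x.
Proof.
move=> oU Ux [_ dd Dd]; have nU := open_nbhs_nbhs (conj oU Ux).
split=> [|v]; first exact: filterS nU.
have gc i : 'D_(delta_mx 0 i) d y @[y --> x] --> 'D_(delta_mx 0 i) d x.
  exact: W1inf_continuous (Dd i).
have : dot v (grad d y) @[y --> x] --> dot v (grad d x).
  apply: (cvg_dot_coord (FF := nbhs_filter x)) => i; last first.
    have -> : (fun y => grad d y 0 i) = 'D_(delta_mx 0 i) d.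
      by apply/funext => y; rewrite mxE.
    by rewrite mxE; exact: gc.
  exact: (@cvg_cst _ _ _ (nbhs x) (nbhs_filter x)).
rewrite -(diff_grad v (dd x Ux)); apply: cvg_trans.
apply: (near_eq_cvg (FF := nbhs_filter x)).
by apply: filterS nU => y Uy; rewrite (diff_grad v (dd y Uy)).
Qed.

Lemma edist_ge0 S x : 0 <= Defs.edist S x.
Proof.
have [->|/set0P S0] := eqVneq S set0; first by rewrite /Defs.edist image_set0 inf0.
apply: lb_le_inf; first by case: S0 => y Sy; exists (enorm (x - y)), y.
by move=> _ [y _ <-]; exact: enorm_ge0.
Qed.

Lemma edist_le S x y : S y -> Defs.edist S x <= enorm (x - y).
Proof.
move=> Sy; apply: ge_inf; last by exists y.
by exists 0 => _ [? _ <-]; exact: enorm_ge0.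
Qed.

Lemma edist_lt S x (e : R) : S !=set0 -> Defs.edist S x < e ->
  exists2 y, S y & enorm (x - y) < e.
Proof.
move=> [y0 Sy0] xe; have [|_ [y Sy <-] ye] := @inf_lt _ _ e _ xe.
  by exists (enorm (x - y0)), y0.
by exists y.
Qed.

Lemma edist_eq0 S x : closed S -> S !=set0 -> Defs.edist S x = 0 -> S x.
Proof.
move=> cS S0 x0; apply: cS => B /nbhs_ballP[e /= e0 eB].
have [|y Sy xy] := edist_lt S0 (x := x) (e := e); first by rewrite x0.
exists y; split=> //; apply: eB; rewrite -ball_normE /=.
exact: le_lt_trans (norm_le_enorm _) xy.
Qed.

Lemma edist_in S x : S x -> Defs.edist S x = 0.
Proof.
move=> Sx; apply/eqP; rewrite eq_le edist_ge0 andbT.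
by apply: le_trans (edist_le x Sx) _; rewrite subrr /enorm dot0l sqrtr0.
Qed.

End Distance.

(** * Level sets *)

Section LevelSet.
Context {R : realType} {N : nat}.
Local Notation V := 'rV[R]_N.
Implicit Types (x y z v n p h : V) (d : V -> R).

Lemma grad_approx d z (e : R) : differentiable d z -> d z = 0 -> 0 < e ->
  exists2 r : R, 0 < r &
    forall h, `|h| < r -> `|d (h + z) - dot h (grad d z)| <= e * `|h|.
Proof.
move=> dd dz e0; have /nbhs_ballP[r /= r0 rb] := diff_approx dd e0.
exists r => // h hr; have := rb h; rewrite /= dz subr0 diff_grad//; apply.
by rewrite -ball_normE /= sub0r normrN.
Qed.

Lemma pos_direction d z h : differentiable d z -> d z = 0 ->
  0 < dot h (grad d z) -> \forall e \near (0 : R)^'+, 0 < d (z + e *: h).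
Proof.
move=> dd dz hp; have h1 : 0 < `|h| + 1 by rewrite ltr_wpDl.
(* With this precision the error is at most half of the linear term. *)
have e0 : 0 < dot h (grad d z) / (2 * (`|h| + 1)) by rewrite divr_gt0// mulr_gt0.
have [r r0 rb] := grad_approx dd dz e0.
have rh : 0 < r / (`|h| + 1) by exact: divr_gt0.
near=> e; have ep : 0 < e by near: e; exact: nbhs_right_gt.
have er : e < r / (`|h| + 1) by near: e; exact: nbhs_right_lt.
rewrite ltr_pdivlMr// in er.
have := rb (e *: h); rewrite normrZ gtr0_norm// dotZl (addrC (e *: h)).
have eh : e * `|h| <= e * (`|h| + 1) by rewrite ler_wpM2l ?ltW// ltrDl.
move=> /(_ (le_lt_trans eh er)); rewrite ler_norml => /andP[+ _].
have : dot h (grad d z) / (2 * (`|h| + 1)) * (e * `|h|) <= e * dot h (grad d z) / 2.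
  rewrite -[leRHS](_ : dot h (grad d z) / (2 * (`|h| + 1)) * (e * (`|h| + 1)) = _).
    by rewrite ler_wpM2l// ltW.
  by field; rewrite gt_eqF.
have := mulr_gt0 ep hp; lra.
Unshelve. all: by end_near. Qed.

(* On the line of direction [p] through [z + r v], the intermediate value
   theorem gives a zero of [d] at distance at most [r |p|]; differentiability
   of [d] at [z] then makes this distance [o(r)].  No continuity in [r] is
   needed since the curve only has to be differentiable at 0. *)
Lemma level_set_curve d z v : C1_at d z -> d z = 0 -> grad d z != 0 ->
  dot v (grad d z) = 0 ->
  exists g : R -> V, [/\ g 0 = z, \forall r \near (0 : R), d (g r) = 0 &
    is_derive (0 : R) (1 : R) g v].
Proof.
move=> dC dz p0 vp; have dd := C1_at_differentiable dC.
set p := grad d z in p0 vp *.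
have pp : 0 < dot p p by exact: dot_gt0.
pose L := `|v| + `|p|.
have L0 : 0 < L by rewrite /L ltr_wpDl// normr_gt0.
have HL r t : `|t| <= `|r| -> `|r *: v + t *: p| <= `|r| * L.
  move=> tr; apply: le_trans (ler_normD _ _) _.
  by rewrite !normrZ mulrDr lerD2l ler_wpM2r.
have Hp r t : dot (r *: v + t *: p) p = t * dot p p.
  by rewrite dotDl !dotZl vp mulr0 add0r.
(* On displacements of norm at most [|r| * L] the error is at most [|r| * dot p p / 2], half of the
   linear term at [t = |r|] and at [t = - |r|]; hence the change of sign. *)
have [r0 r00 r0b] := grad_approx dd dz (divr_gt0 pp (mulr_gt0 (@ltr0n R 2) L0)).
have [r1 r10 r1c] : exists2 r1 : R, 0 < r1 &
    forall h, `|h| < r1 -> {for h + z, continuous d}.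
  have /nbhs_ballP[r1 /= r10 r1b] := dC.1.
  exists r1 => // h hr; apply/differentiable_continuous/r1b.
  by rewrite -ball_normE /= opprD addrCA subrr addr0 normrN.
pose rho := Num.min r0 r1 / L.
have rho0 : 0 < rho by rewrite divr_gt0// lt_min r00.
have small r t : `|r| < rho -> `|t| <= `|r| ->
    `|r *: v + t *: p| < r0 /\ `|r *: v + t *: p| < r1.
  move=> rr tr; apply/andP; rewrite -lt_min; apply: le_lt_trans (HL _ _ tr) _.
  by rewrite -ltr_pdivlMr.
have zero r : `|r| < rho -> exists t, `|t| <= `|r| /\
    d (r *: v + t *: p + z) = 0.
  move=> rr; have r_ge0 := normr_ge0 r.
  have approx t : `|t| <= `|r| ->
      `|d (r *: v + t *: p + z) - t * dot p p| <= `|r| * (dot p p / 2).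
    move=> tr; rewrite -(Hp r); apply: le_trans (r0b _ (small _ _ rr tr).1) _.
    apply: (@le_trans _ _ (dot p p / (2 * L) * (`|r| * L))).
      by rewrite ler_wpM2l ?HL// ltW// divr_gt0// mulr_gt0.
    by rewrite le_eqVlt; apply/orP; left; apply/eqP; field; rewrite gt_eqF.
  have rp := mulr_ge0 r_ge0 (ltW pp).
  have := approx `|r|; rewrite normr_id lexx => /(_ isT).
  rewrite ler_norml => /andP[up _].
  have := approx (- `|r|); rewrite normrN normr_id lexx => /(_ isT).
  rewrite ler_norml => /andP[_ lo].
  have [|||t] := @IVT R (fun t => d (r *: v + t *: p + z)) (- `|r|) `|r| 0.
  - by rewrite ge0_cp.
  - apply: continuous_in_subspaceT => t; rewrite inE /= in_itv /= -ler_norml.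
    move=> tr; have := r1c _ (small _ _ rr tr).2.
    apply: (@continuous_comp _ _ _ (fun t : R => r *: v + t *: p + z) d).
    apply: (@differentiable_continuous _ _ _ t (fun t : R => r *: v + t *: p + z)).
    by [].
  - by rewrite ge_min le_max; apply/andP; split; apply/orP; [left|right]; lra.
  - by rewrite in_itv/= -ler_norml => tr dt0; exists t.
(* Some zero is chosen for each small [r]. The default value 0 can occur without a zero only for
   [|r| >= rho], away from the base point of the curve. *)
pose tau r := xget 0 [set t | `|t| <= `|r| /\ d (r *: v + t *: p + z) = 0].
have tauP r : `|r| < rho -> `|tau r| <= `|r| /\
    d (r *: v + tau r *: p + z) = 0.
  by move=> /zero[t tP]; rewrite /tau; case: xgetP => [t' _ //|/(_ t)].
have tau0 : tau 0 = 0.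
  have [] := tauP 0; first by rewrite normr0.
  by rewrite normr0 normr_le0 => /eqP.
have nrho : \forall r \near (0 : R), `|r| < rho by exact: nbhs0_lt.
exists (fun r => r *: v + tau r *: p + z); split.
- by rewrite tau0 !scale0r !add0r.
- by apply: filterS nrho => r /tauP[].
have cvgv : (fun h : R => h^-1 *: ((h *: 1 + 0) *: v + tau (h *: 1 + 0) *: p + z
    - (0 *: v + tau 0 *: p + z))) @ 0^' --> v.
  have -> : (fun h : R => h^-1 *: ((h *: 1 + 0) *: v + tau (h *: 1 + 0) *: p + z
    - (0 *: v + tau 0 *: p + z))) =
    (fun h : R => (h^-1 * h) *: v + (h^-1 * tau h) *: p).
    rewrite funeqE => h; rewrite addr0 (_ : h *: 1 = h); last exact: mulr1.
    by rewrite tau0 !scale0r !add0r addrK scalerDr !scalerA.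
  apply/(@cvgrPdist_le _ _ _ _ (dnbhs_filter 0)) => e e0.
  (* This choice turns the bound on [|tau h| * dot p p] into [|tau h| * (|p| + 1) <= e * |h|]. *)
  pose e' := e * dot p p / (L * (`|p| + 1)).
  have p1 : 0 < `|p| + 1 by rewrite ltr_wpDl.
  have e'0 : 0 < e' by rewrite divr_gt0// mulr_gt0.
  have [r2 r20 r2b] := grad_approx dd dz e'0.
  have nr : \forall h \near (0 : R)^', `|h| < Num.min rho (r2 / L).
    by apply: dnbhs0_lt; rewrite lt_min rho0 divr_gt0.
  have nh : \forall h \near (0 : R)^', h != 0 by exact: nbhs_dnbhs_neq.
  apply: filterS2 nr nh => h; rewrite lt_min => /andP[hrho hr2] h0.
  rewrite mulVf// scale1r opprD addrA subrr add0r normrN normrZ normrM normfV.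
  have [tauh dtau] := tauP _ hrho.
  have hn0 : 0 < `|h| by rewrite normr_gt0.
  have := r2b (h *: v + tau h *: p).
  rewrite ltr_pdivlMr// in hr2; move=> /(_ (le_lt_trans (HL _ _ tauh) hr2)).
  rewrite dtau sub0r normrN Hp normrM (gtr0_norm pp) => tb.
  have {}tb : `|tau h| * dot p p <= e' * (`|h| * L).
    by apply: le_trans tb _; rewrite ler_wpM2l ?HL// ltW.
  rewrite -mulrA ler_pdivrMl//.
  apply: (@le_trans _ _ (`|tau h| * (`|p| + 1))).
    by rewrite ler_wpM2l// lerDl.
  rewrite -(@ler_pM2r _ (dot p p))//.
  rewrite (_ : `|h| * e * dot p p = e' * (`|h| * L) * (`|p| + 1)).
    by rewrite mulrAC ler_wpM2r// ltW.
  by rewrite /e'; field; rewrite !gt_eqF.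
by apply: DeriveDef; [apply/cvg_ex; exists v|exact: cvg_lim].
Unshelve. all: by end_near. Qed.

End LevelSet.

(** * Signed distance to the hypersurface *)

Section Hypersurface.
Context {R : realType} {N : nat}.
Local Notation V := 'rV[R]_N.
Variables (O1 O2 S : set V).
Hypothesis HO : HOmega O1 O2 S.
Implicit Types (x y z v n : V).
Local Notation d := (sdist O1 S).

Lemma hypersurface_notin x : S x -> ~ O1 x /\ ~ O2 x.
Proof.
have [[oO1 oO2] _ _ [S1 S2] _] := HO.
move=> Sx; split=> Ox.
  by move: Sx; rewrite S1 => -[_]; apply; exact: open_nbhs_nbhs.
by move: Sx; rewrite S2 => -[_]; apply; exact: open_nbhs_nbhs.
Qed.

Lemma hypersurface_closure x : S x -> closure O1 x /\ closure O2 x.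
Proof.
have [_ _ _ [S1 S2] _] := HO.
by move=> Sx; split; [move: Sx; rewrite S1 => -[]|move: Sx; rewrite S2 => -[]].
Qed.

Lemma hypersurface_closed : closed S.
Proof.
have [_ _ _ [-> _] _] := HO; apply: closedI; first exact: closed_closure.
exact/open_closedC/open_interior.
Qed.

Lemma sdist_ge0 x : O1 x -> 0 <= d x.
Proof. by move=> Ox; rewrite /sdist asboolT// edist_ge0. Qed.

Lemma sdist_le0 x : ~ O1 x -> d x <= 0.
Proof. by move=> Ox; rewrite /sdist asboolF// oppr_le0 edist_ge0. Qed.

Lemma sdist_in x : S x -> d x = 0.
Proof. by move=> Sx; rewrite /sdist edist_in// oppr0 if_same. Qed.

Lemma sdist_norm x : `|d x| = Defs.edist S x.
Proof.
have e0 := edist_ge0 S x.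
by rewrite /sdist; case: asboolP => _; [|rewrite normrN]; rewrite ger0_norm.
Qed.

(** Nonemptiness is assumed because the infimum of the empty set is 0, which would make [d] vanish
    everywhere. *)
Lemma sdist_eq0 x : S !=set0 -> d x = 0 -> S x.
Proof.
move=> S0 dx; apply: edist_eq0 => //; first exact: hypersurface_closed.
by rewrite -sdist_norm dx normr0.
Qed.

Lemma sdist_gt0 x : 0 < d x -> O1 x.
Proof.
move=> dx; apply: contrapT => Ox; have := sdist_le0 Ox; lra.
Qed.

Lemma sdist_lt0 x : d x < 0 -> O2 x.
Proof.
have [_ _ cover _ _] := HO.
move=> dx; have : setT x by []; rewrite -cover => -[[/sdist_ge0|//]|/sdist_in].
  by rewrite leNgt dx.
by move=> d0; rewrite d0 ltxx in dx.
Qed.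

Lemma sdist_C1_near z : S z -> \forall y \near z, C1_at d y.
Proof.
have [_ _ _ _ [U [oU SU dU]]] := HO.
move=> /SU Uz; have := open_nbhs_nbhs (conj oU Uz).
by apply: filterS => y Uy; exact: W2inf_C1_at dU.
Qed.

Lemma sdist_C1 z : S z -> C1_at d z.
Proof. by move=> /sdist_C1_near/nbhs_singleton. Qed.

(* Were the gradient zero at [z], [d] would be Lipschitz near [z] with constant
   1/2, contradicting [d x = inf_y |x - y|] over [y] in [S], where [d y = 0]. *)
Lemma grad_sdist_neq0 z : S z -> grad d z != 0.
Proof.
move=> Sz; apply/eqP => g0.
have dC := sdist_C1 Sz.
have gc i : 'd d y (delta_mx 0 i) @[y --> z] --> (0 : R).
  by have := dC.2 (delta_mx 0 i); rewrite [X in _ --> X](_ : _ = 0)// diff_grad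
    ?g0 1?dotC ?dot0l//; exact: C1_at_differentiable.
(* The sum of [N] partial derivatives of this size is at most 1/2. *)
have N1 : 0 < (2 * (N%:R + 1))^-1 :> R by rewrite invr_gt0 mulr_gt0// ltr_wpDl.
have gsmall : \forall y \near z, differentiable d y /\
    forall i, `|'d d y (delta_mx 0 i)| < (2 * (N%:R + 1))^-1.
  have nd := dC.1.
  have : \forall y \near z, forall i, `|'d d y (delta_mx 0 i)| < (2 * (N%:R + 1))^-1.
    apply: (@filter_forall _ _ _ _ (nbhs_filter z)) => i.
    exact: (@cvgr0_norm_lt _ _ _ _ (nbhs_filter z) _ (gc i) _ N1).
  exact: filterI nd.
have /nbhs_ballP[r /= r0 rb] := gsmall.
(* The point [y] below is within [2 * d x <= 2 * N * |z - x|] of [x], so [|z - y|] is at most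
   [(2 * N + 1) * |z - x|], which this radius keeps below [r]. *)
have r4 : 0 < r / (4 * (N%:R + 1)).
  by rewrite divr_gt0// mulr_gt0// ltr_wpDl.
have [x [xO1 xz]] := (hypersurface_closure Sz).1 _ (nbhsx_ballx z _ r4).
have dx0 : 0 < d x.
  rewrite lt_neqAle sdist_ge0// andbT eq_sym; apply/eqP => dx.
  by have [] := hypersurface_notin (sdist_eq0 (ex_intro _ z Sz) dx).
have dxE : Defs.edist S x = d x by rewrite -sdist_norm gtr0_norm.
have [|y Sy xy] := edist_lt (ex_intro _ z Sz) (x := x) (e := 2 * d x).
  by rewrite dxE; lra.
rewrite -ball_normE /= ltr_pdivlMr in xz; last by rewrite mulr_gt0// ltr_wpDl.
have dxz : d x <= N%:R * `|z - x|.
  rewrite -dxE; apply: le_trans (edist_le x Sz) _.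
  by rewrite -enormN opprB enorm_le_norm.
have zx0 := normr_ge0 (z - x).
have zr : ball z r x by rewrite -ball_normE /=; have := ler0n R N; nra.
have zy : ball z r y.
  rewrite -ball_normE /= -(subrKA x); apply: le_lt_trans (ler_normD _ _) _.
  by have := norm_le_enorm (x - y); have := ler0n R N; nra.
have [u zu] := mean_value_ball (fun u zu => (rb u zu).1) zr zy.
have [du gu] := rb u zu.
rewrite (sdist_in Sy) subr0 diff_grad// => dxu.
have := dot_le_enorm (x - y) (grad d u); rewrite -dxu gtr0_norm//.
have sumle : \sum_i `|grad d u 0 i| <= 2^-1.
  apply: (@le_trans _ _ (\sum_(i < N) (2 * (N%:R + 1))^-1)).
    by apply: ler_sum => i _; rewrite mxE deriveE// ltW.
  rewrite sumr_const card_ord -[leLHS]mulr_natl ler_pdivrMr ?mulr_gt0 ?ltr_wpDl//.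
  by rewrite mulrA mulVf// mul1r lerDl.
have := ler_wpM2l (enorm_ge0 (x - y)) sumle; lra.
Qed.

(** Along a curve on [S] the function [d] is constantly zero near the base point, so its derivative
    vanishes. Conversely, [level_set_curve] produces a curve in the zero set of [d], which is
    [S]. *)
Lemma tangent_spaceP z v : S z ->
  tangent_space S z v <-> dot v (grad d z) = 0.
Proof.
move=> Sz; have dC := sdist_C1 Sz; have dd := C1_at_differentiable dC.
split=> [[g [g0 gS gv]]|vp].
  rewrite -diff_grad//; move: dd; rewrite -g0 => dd.
  have [_ <-] := is_derive_comp_curve dd gv.
  have -> : 'D_1 (fun r => d (g r)) 0 = 'D_1 (cst 0 : R -> R) (0 : R).
    by apply: near_eq_derive; apply: filterS gS => r /sdist_in.
  exact: derive_cst.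
have [g [g0 gz gv]] := level_set_curve dC (sdist_in Sz) (grad_sdist_neq0 Sz) vp.
exists g; split=> //; apply: filterS gz => r; apply: sdist_eq0.
by exists z.
Qed.

(** The normal vanishes on the tangent space, which is the orthogonal of the gradient, so it is a
    multiple of the gradient; the multiple is nonzero since [n] is a unit vector. *)
Lemma normal_colinear O z n : S z -> S = boundary O ->
  outward_unit_normal O z n -> exists2 k, k != 0 & n = k *: grad d z.
Proof.
move=> Sz SO [n1 nT _].
have nE := dot_orthogonal_complement (grad_sdist_neq0 Sz)
  (fun v vp => nT v (eq_ind _ (fun X => tangent_space X z v)
     ((tangent_spaceP v Sz).2 vp) _ SO)).
exists (dot n (grad d z) / dot (grad d z) (grad d z)) => //.
apply: contra_eqN n1 => /eqP k0; rewrite nE k0 scale0r /enorm dot0l sqrtr0.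
by rewrite eq_sym oner_eq0.
Qed.

(** With the other sign, [d] would be positive just after [z] along [n], so that [n] would enter
    [O1]. *)
Lemma normal1 z n : S z -> outward_unit_normal O1 z n ->
  exists2 k, 0 < k & n = (- k) *: grad d z.
Proof.
move=> Sz nP; have [_ _ _ [S1 _] _] := HO.
have [k k0 nE] := normal_colinear Sz S1 nP.
exists (- k); last by rewrite opprK.
rewrite oppr_gt0 lt_neqAle k0 leNgt; apply/negP => kp.
have [_ _ nout] := nP.
have : \forall e \near (0 : R)^'+, 0 < d (z + e *: n).
  apply: pos_direction; first exact: C1_at_differentiable (sdist_C1 Sz).
    exact: sdist_in.
  by rewrite nE dotZl mulr_gt0// dot_gt0// grad_sdist_neq0.
move=> /(filterI nout)/filter_ex[e [nc /sdist_gt0 Oe]].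
by apply: nc; exact: subset_closure.
Qed.

(** The argument of [normal1] is applied to [- d], as negative values of [d] occur in [O2] only. *)
Lemma normal2 z n : S z -> outward_unit_normal O2 z n ->
  exists2 k, 0 < k & n = k *: grad d z.
Proof.
move=> Sz nP; have [_ _ _ [_ S2] _] := HO.
have [k k0 nE] := normal_colinear Sz S2 nP.
exists k => //; rewrite lt_neqAle eq_sym k0 leNgt; apply/negP => kn.
have [_ _ nout] := nP.
have dd := C1_at_differentiable (sdist_C1 Sz).
have gN : grad (- d) z = - grad d z.
  by apply/rowP => i; rewrite !mxE deriveN//; exact: diff_derivable.
have : \forall e \near (0 : R)^'+, 0 < (- d) (z + e *: n).
  apply: pos_direction; first exact: differentiableN.
    by rewrite fctE sdist_in// oppr0.
  rewrite gN nE dotC dotNl dotZr -mulNr mulr_gt0 ?oppr_gt0//.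
  by rewrite dot_gt0// grad_sdist_neq0.
move=> /(filterI nout)/filter_ex[e [nc]]; rewrite fctE oppr_gt0.
by move=> /sdist_lt0 Oe; apply: nc; exact: subset_closure.
Qed.

End Hypersurface.

(** * Controls and Hamiltonians *)

Section Control.
Context {R : realType} {N : nat} {A : metricType R}.
Local Notation V := 'rV[R]_N.
Local Notation W := (V * R)%type.
Variables (U : set V) (T : R) (b : V -> R -> A -> V) (l : V -> R -> A -> R).
Hypotheses (bP : hypC1 U T b) (lP : hypC2 U T l).
Implicit Types (z y : W) (p : V) (a : A) (g : W -> R).

(** The bounds on [b] and [l] make the set bounded above, so that [sup] is an upper bound of it. *)
Lemma hamiltonian_ge z p a : closure U z.1 -> 0 <= z.2 <= T ->
  - dot (b z.1 z.2 a) p - l z.1 z.2 a <= hamiltonian b l z p.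
Proof.
move=> Uz zT; have [_ _ [Mb bM] _] := bP; have [_ [Ml lM] _] := lP.
apply: ub_le_sup; last by exists a.
exists (Mb * (\sum_i `|p 0 i|) + Ml) => _ [c _ <-].
apply: lerD.
  rewrite -dotNl; apply: le_trans (ler_norm _) _.
  apply: le_trans (dot_le_enorm _ _) _; rewrite enormN ler_wpM2r ?bM//.
  exact: sumr_ge0.
by apply: le_trans (ler_norm _) _; rewrite normrN; exact: lM.
Qed.

(** The differential along [(- b, 1)] is [dt g - b . Dg]; a single control with a positive gap
    therefore contradicts the subsolution inequality. *)
Lemma hamiltonian_gt0 g z a : differentiable g z ->
  closure U z.1 -> 0 <= z.2 <= T ->
  0 < 'd g z (- b z.1 z.2 a, 1) - l z.1 z.2 a ->
  0 < dt g z + hamiltonian b l z (gradx g z).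
Proof.
move=> dg Uz zT; rewrite diff_gradx_dt// dotNl mul1r.
have := hamiltonian_ge (gradx g z) a Uz zT; lra.
Qed.

Lemma open_cylinder_near z : open_cylinder T z ->
  \forall y \near z, open_cylinder T y.
Proof.
move=> /andP[z0 zT].
have c : {for z, continuous (fun y : W => y.2)} by exact: cvg_snd.
have h1 : \forall y \near z, 0 < y.2 by exact: (cvgr_gt _ c _ z0).
have h2 : \forall y \near z, y.2 < T by exact: (cvgr_lt _ c _ zT).
by apply: filterS2 h1 h2 => y y0 yT; rewrite /open_cylinder /= y0.
Qed.

Lemma open_cylinderW z : open_cylinder T z -> closed_cylinder T z.
Proof. by rewrite /open_cylinder /closed_cylinder /= => /andP[/ltW-> /ltW->]. Qed.

(** Limits are restricted to the closure of [U], where alone the hypotheses on [b] and [l] give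
    information. *)
Let F z := within [set y : W | closure U y.1] (nbhs z).

Lemma enorm_fst_le z y : enorm (z.1 - y.1) <= N%:R * `|z - y|.
Proof.
apply: le_trans (enorm_le_norm _) _; rewrite ler_wpM2l//.
by rewrite [`|z - y|]/(Num.max _ _) le_max lexx.
Qed.

Lemma abs_snd_le z y : `|z.2 - y.2| <= `|z - y|.
Proof. by rewrite [`|z - y|]/(Num.max _ _) le_max lexx orbT. Qed.

Lemma near_closure_dist z (e : R) : open_cylinder T z -> 0 < e ->
  \forall y \near F z, [/\ closure U y.1, 0 <= y.2 <= T,
    enorm (z.1 - y.1) < e & `|z.2 - y.2| < e].
Proof.
move=> zT e0; have N1 : 0 < N%:R + 1 :> R by rewrite ltr_wpDl.
have nb : \forall y \near z, ball z (e / (N%:R + 1)) y.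
  by apply: nbhsx_ballx; exact: divr_gt0.
apply: filterS2 nb (open_cylinder_near zT) => y.
rewrite -ball_normE /= ltr_pdivlMr// => zy /open_cylinderW yT Uy.
have zy0 := normr_ge0 (z - y); have N0 := ler0n R N.
split=> //.
  by apply: le_lt_trans (enorm_fst_le _ _) _; lra.
apply: le_lt_trans (abs_snd_le _ _) _.
by have := mulr_ge0 zy0 N0; lra.
Qed.

Lemma cvg_drift z a : closure U z.1 -> open_cylinder T z ->
  (fun y => b y.1 y.2 a) @ F z --> b z.1 z.2 a.
Proof.
move=> Uz zT; have [_ _ _ [Lb bL]] := bP.
apply: (iffRL (@cvgrPdist_lt _ _ _ (F z) _ _ _)) => e e0.
have L0 : 0 < 2 * (Num.max Lb 0 + 1).
  by rewrite mulr_gt0// ltr_wpDl// le_max lexx orbT.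
have := near_closure_dist zT (divr_gt0 e0 L0).
apply: filterS => y [Uy yT zy1 zy2].
apply: le_lt_trans (norm_le_enorm _) _.
apply: le_lt_trans (bL _ _ _ _ a Uz Uy (open_cylinderW zT) yT) _.
have h0 : 0 <= enorm (z.1 - y.1) + `|z.2 - y.2| by rewrite addr_ge0 ?enorm_ge0.
apply: (@le_lt_trans _ _ ((Num.max Lb 0 + 1) * (enorm (z.1 - y.1) + `|z.2 - y.2|))).
  by rewrite ler_wpM2r// ler_wpDr// le_max lexx.
rewrite ltr_pdivlMr// in zy1; rewrite ltr_pdivlMr// in zy2.
lra.
Qed.

Lemma cvg_cost z a : closure U z.1 -> open_cylinder T z ->
  (fun y => l y.1 y.2 a) @ F z --> l z.1 z.2 a.
Proof.
move=> Uz zT; have [lU _ _] := lP.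
apply: (iffRL (@cvgrPdist_lt _ _ _ (F z) _ _ _)) => e e0.
have [r r0 lr] := lU _ e0.
apply: filterS (near_closure_dist zT r0) => y [Uy yT zy1 zy2].
by apply: lr => //; [exact: open_cylinderW|rewrite mdistxx].
Qed.

(** The coefficients let one statement cover the gap of a control ([k = m = 1]) and the direction in
    which the drift moves [D] ([k] equal to 1 or -1, [m = 0]). *)
Lemma diff_control_near g z a (k s m : R) :
  C1_at g z -> closure U z.1 -> open_cylinder T z ->
  0 < k * 'd g z (- b z.1 z.2 a, s) - m * l z.1 z.2 a ->
  \forall y \near z, closure U y.1 ->
    0 < k * 'd g y (- b y.1 y.2 a, s) - m * l y.1 y.2 a.
Proof.
move=> gC Uz zT.
have bc : (fun y => - b y.1 y.2 a) @ F z --> - b z.1 z.2 a.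
  by apply: cvgN; exact: cvg_drift.
have yc : (fun y => y) @ F z --> z by exact: cvg_within.
have c : (fun y => k * 'd g y (- b y.1 y.2 a, s) - m * l y.1 y.2 a) @ F z -->
    k * 'd g z (- b z.1 z.2 a, s) - m * l z.1 z.2 a.
  apply: cvgB; last by apply: cvgM; [exact: cvg_cst|exact: cvg_cost].
  apply: cvgM; first exact: cvg_cst.
  exact: (cvg_diff gC yc bc).
by move=> /(cvgr_gt _ c).
Qed.

End Control.

(** * The viscosity inequality for a pair of strictly outward controls *)

Section Subsolution.
Context {R : realType} {N : nat} {A1 A2 : metricType R}.
Local Notation V := 'rV[R]_N.
Local Notation W := (V * R)%type.
Variables (O1 O2 S : set V) (T : R).
Variables (b1 : V -> R -> A1 -> V) (l1 : V -> R -> A1 -> R).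
Variables (b2 : V -> R -> A2 -> V) (l2 : V -> R -> A2 -> R).
Hypotheses (HO : HOmega O1 O2 S).
Hypotheses (b1P : hypC1 O1 T b1) (b2P : hypC1 O2 T b2).
Hypotheses (l1P : hypC2 O1 T l1) (l2P : hypC2 O2 T l2).
Implicit Types (z y : W) (psi w : W -> R).

Local Notation d := (sdist O1 S).

Lemma near_fst (P : set V) z :
  (\forall x \near z.1, P x) -> \forall y \near z, P y.1.
Proof.
have c : {for z, continuous (@fst V R)} by exact: cvg_fst.
exact: c.
Qed.

Lemma C1_at_fst (f : V -> R) z : C1_at f z.1 -> C1_at (fun y : W => f y.1) z.
Proof.
by apply: (@C1_at_comp_linear _ _ _ f (@fst V R)) => y; exact: cvg_fst.
Qed.

Lemma diff_fst (f : V -> R) z (v : V) (s : R) : C1_at f z.1 ->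
  'd (fun y : W => f y.1) z (v, s) = 'd f (z.1) v.
Proof.
move=> fC; rewrite -(deriveE _ (C1_at_differentiable (C1_at_fst fC))).
by rewrite -(deriveE _ (C1_at_differentiable fC)).
Qed.

(** Semicontinuity relative to the closed cylinder is ordinary semicontinuity at interior points. *)
Lemma usc_cyl_near w z : usc_cyl T w -> open_cylinder T z ->
  \forall y \near z, usc_at w y.
Proof.
move=> wU zT; apply: filterS (open_cylinder_near zT) => y yT a wya.
have wa : \forall x \near y, closed_cylinder T x -> w x < a.
  exact: wU y (open_cylinderW yT) a wya.
by apply: filterS2 wa (open_cylinder_near yT) => x xa /open_cylinderW/xa.
Qed.

(** Here [e] is the value of [D], [y] its derivative along the drift, and [c * (2 * e * y)] the
    derivative of the penalization; the factors 1 and 0 match [diff_control_near]. *)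
Lemma penalized_gap_gt0 (x y l c e : R) :
  0 < 1 * x - 1 * l -> 0 < 1 * y - 0 * l -> 0 <= c -> 0 <= e ->
  0 < x + c * (2 * e * y) - l.
Proof.
rewrite !mul1r mul0r subr0 => xl /ltW y0 c0 e0.
by have := mulr_ge0 (mulr_ge0 c0 e0) y0; lra.
Qed.

(* Adding [eta * d] to the test function moves the two Hamiltonian gaps by
   [+ eta beta1] and [- eta beta2].  If the weighted sum below were positive,
   some [eta] would make both gaps positive, and the penalization [C d^2] only
   increases them, as the drifts point towards the hypersurface from inside. *)
Lemma weighted_gap_le0 w psi z a1 a2 :
  visc_sub O1 O2 S T b1 l1 b2 l2 w ->
  S z.1 -> open_cylinder T z ->
  (\forall y \near z, C1_at psi y) ->
  (\forall y \near z, S y.1 -> w y - psi y <= w z - psi z) ->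
  let beta1 := - dot (b1 z.1 z.2 a1) (grad d z.1) in
  let beta2 := dot (b2 z.1 z.2 a2) (grad d z.1) in
  0 < beta1 -> 0 < beta2 ->
  beta2 * ('d psi z (- b1 z.1 z.2 a1, 1) - l1 z.1 z.2 a1) +
  beta1 * ('d psi z (- b2 z.1 z.2 a2, 1) - l2 z.1 z.2 a2) <= 0.
Proof.
move=> [_ wU wsub] Sz zT psiC wmax beta1 beta2 beta1_gt0 beta2_gt0.
set f1 := (X in beta2 * X); set f2 := (X in beta1 * X).
rewrite leNgt; apply/negP => gap.
(* With this value [f1 / beta1 + eta] and [f2 / beta2 - eta] both equal the mean of [f1 / beta1] and
   [f2 / beta2]. *)
pose eta := (f2 / beta2 - f1 / beta1) / 2.
have gap1 : 0 < f1 + eta * beta1.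
  rewrite (_ : _ + _ = (beta2 * f1 + beta1 * f2) / (2 * beta2)).
    by rewrite divr_gt0// mulr_gt0.
  by rewrite /eta; field; rewrite !gt_eqF.
have gap2 : 0 < f2 - eta * beta2.
  rewrite (_ : _ - _ = (beta2 * f1 + beta1 * f2) / (2 * beta1)).
    by rewrite divr_gt0// mulr_gt0.
  by rewrite /eta; field; rewrite !gt_eqF.
pose D (y : W) := d y.1.
pose G := psi + (fun y => eta * D y).
(* The differential of [qdist z] vanishes at [z], so the gaps of [GQ] are positive at [z] like those
   of [G], and remain so nearby. *)
pose GQ := G + qdist z.
have [cl1 cl2] := hypersurface_closure HO Sz.
have Sne : S !=set0 by exists z.1.
have dC := sdist_C1 HO Sz.
have DC : \forall y \near z, C1_at D y.
  have dnear := near_fst (sdist_C1_near HO Sz).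
  by apply: filterS dnear => y; exact: C1_at_fst.
have D0 : D z = 0 by exact: sdist_in.
have dD v s : 'd D z (v, s) = dot v (grad d z.1).
  by rewrite (diff_fst _ _ dC) (diff_grad _ (C1_at_differentiable dC)).
have GC y : C1_at psi y -> C1_at D y -> C1_at G y.
  by move=> psiy Dy; apply: (C1_atD psiy); exact: C1_atZ.
have GQC y : C1_at psi y -> C1_at D y -> C1_at GQ y.
  by move=> psiy Dy; apply: (C1_atD (GC _ psiy Dy)); exact: C1_at_qdist.
have psiz := nbhs_singleton psiC; have Dz := nbhs_singleton DC.
have dGQ v s : 'd GQ z (v, s) = 'd psi z (v, s) + eta * dot v (grad d z.1).
  have dq := C1_at_differentiable (C1_at_qdist z z).
  have e1 : 'd GQ z (v, s) = 'd G z (v, s) + 'd (qdist z) z (v, s) :=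
    diffD_apply (v, s) (C1_at_differentiable (GC _ psiz Dz)) dq.
  have e2 : 'd G z (v, s) = 'd psi z (v, s) + 'd (fun y => eta * D y) z (v, s) :=
    diffD_apply (v, s) (C1_at_differentiable psiz)
      (C1_at_differentiable (C1_atZ eta Dz)).
  have e3 : 'd (fun y => eta * D y) z (v, s) = eta * 'd D z (v, s) :=
    diffZ_apply eta (v, s) (C1_at_differentiable Dz).
  have e4 : 'd (qdist z) z (v, s) = 0 := diff_qdist z (v, s).
  apply: (etrans e1); apply: (etrans (f_equal2 +%R e2 e4)); rewrite addr0.
  by congr (_ + _); apply: (etrans e3); congr (_ * _); exact: dD.
have GQE y : GQ y = psi y + eta * D y + qdist z y by [].
have GE y : G y = psi y + eta * D y by [].
have DE y : D y = d y.1 by [].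
clearbody GQ G D.
have near1 : \forall y \near z, closure O1 y.1 ->
    0 < 1 * 'd GQ y (- b1 y.1 y.2 a1, 1) - 1 * l1 y.1 y.2 a1.
  apply: (diff_control_near b1P l1P (GQC _ psiz Dz) cl1 zT).
  by rewrite !mul1r (dGQ _ 1) dotNl; move: gap1; rewrite /f1 /beta1; lra.
have near2 : \forall y \near z, closure O2 y.1 ->
    0 < 1 * 'd GQ y (- b2 y.1 y.2 a2, 1) - 1 * l2 y.1 y.2 a2.
  apply: (diff_control_near b2P l2P (GQC _ psiz Dz) cl2 zT).
  by rewrite !mul1r (dGQ _ 1) dotNl; move: gap2; rewrite /f2 /beta2; lra.
(* The derivative of [D] along [(- b_i, 1)] is positive on the first side and negative on the
   second: it has the sign of [D], which makes the derivative of [C * D ^+ 2] nonnegative. *)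
have in1 : \forall y \near z, closure O1 y.1 ->
    0 < 1 * 'd D y (- b1 y.1 y.2 a1, 1) - 0 * l1 y.1 y.2 a1.
  apply: (diff_control_near b1P l1P Dz cl1 zT).
  by rewrite mul1r mul0r subr0 (dD _ 1) dotNl.
have in2 : \forall y \near z, closure O2 y.1 ->
    0 < -1 * 'd D y (- b2 y.1 y.2 a2, 1) - 0 * l2 y.1 y.2 a2.
  apply: (diff_control_near b2P l2P Dz cl2 zT).
  by rewrite mulN1r mul0r subr0 (dD _ 1) dotNl opprK.
(* None of the conditions collected around [z] involves [C], so they hold at the maximum point [z']
   however large [C] has to be. *)
have [|||z' [C [[[[yT [psiC' DC']] [n1 n2]] [i1 i2]] C0 zmax]]] :=
    @penalized_max _ _ (fun y => w y - G y) D z _ _ _ D0 _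
    (filterI (filterI (filterI (open_cylinder_near zT)
       (filterI (near_join psiC) (near_join DC)))
       (filterI near1 near2)) (filterI in1 in2)).
- apply: filterS2 (usc_cyl_near wU zT) (filterI psiC DC) => y wy [psiy Dy].
  by apply: usc_atB wy _; exact: C1_at_continuous (GC _ psiy Dy).
- by apply: filterS DC => y; exact: C1_at_continuous.
- apply: filterS wmax => y wy Dy0; have Sy : S y.1.
    by apply: (sdist_eq0 HO) => //; rewrite -DE.
  by rewrite !GE Dy0 D0 mulr0 !addr0; exact: wy.
pose F0 := GQ + (fun y => C * D y ^+ 2).
have D2C y : C1_at D y -> C1_at (fun y => D y ^+ 2) y by exact: C1_at_sqr.
have F0C : \forall y \near z', C1_at F0 y.
  apply: filterS2 psiC' DC' => y psiy Dy.
  by apply: (C1_atD (GQC _ psiy Dy)); exact: C1_atZ (D2C _ Dy).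
have psiz' := nbhs_singleton psiC'; have Dz' := nbhs_singleton DC'.
have dF0 v s : 'd F0 z' (v, s) = 'd GQ z' (v, s) + C * (2 * D z' * 'd D z' (v, s)).
  have dDz' := C1_at_differentiable Dz'.
  have dD2 := C1_at_differentiable (D2C _ Dz').
  have e1 : 'd F0 z' (v, s) =
      'd GQ z' (v, s) + 'd (fun y => C * D y ^+ 2) z' (v, s) :=
    diffD_apply (v, s) (C1_at_differentiable (GQC _ psiz' Dz'))
      (C1_at_differentiable (C1_atZ C (D2C _ Dz'))).
  have e2 : 'd (fun y => C * D y ^+ 2) z' (v, s) =
      C * 'd (fun y => D y ^+ 2) z' (v, s) := diffZ_apply C (v, s) dD2.
  have e3 : 'd (fun y => D y ^+ 2) z' (v, s) = 2 * D z' * 'd D z' (v, s) :=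
    diff_sqr_apply (v, s) dDz'.
  by rewrite [LHS]e1 [X in _ + X]e2 [X in _ + _ * X]e3.
have F0E y : F0 y = psi y + eta * D y + qdist z y + C * D y ^+ 2.
  by rewrite -GQE.
have wF0 y : w y - F0 y = w y - G y - (qdist z y + C * D y ^+ 2).
  by rewrite (F0E y) (GE y); ring.
clearbody F0.
have [g [gC gF]] := C1_cutoff F0C.
have Fg : {near z', F0 =1 g} by apply: filterS gF => y ->.
have [dg dgE] := differentiable_near_eq Fg (C1_at_differentiable (nbhs_singleton F0C)).
have gmax : \forall y \near z', w y - g y <= w z' - g z'.
  have gz := nbhs_singleton gF.
  apply: filterS2 zmax gF => y ymax gy; rewrite gy gz.
  by rewrite (wF0 y) (wF0 z').
have [sub1 sub2 subS] := wsub g (fun y _ => conj (C1_at_differentiable (gC y))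
  (gC y).2) z' yT gmax.
have yT' := open_cylinderW yT.
have dgF0 v : 'd g z' (v, 1) = 'd GQ z' (v, 1) + C * (2 * D z' * 'd D z' (v, 1)).
  by apply: (etrans (congr1 (fun h => h (v, 1)) dgE)); exact: dF0.
have pos1 : closure O1 z'.1 -> 0 <= D z' ->
    0 < dt g z' + hamiltonian b1 l1 z' (gradx g z').
  move=> cl Dpos; apply: (hamiltonian_gt0 b1P l1P (a := a1)) => //.
  by rewrite (dgF0 _); exact: penalized_gap_gt0 (n1 cl) (i1 cl) C0 Dpos.
have pos2 : closure O2 z'.1 -> D z' <= 0 ->
    0 < dt g z' + hamiltonian b2 l2 z' (gradx g z').
  move=> cl; rewrite -oppr_ge0 => Dneg.
  apply: (hamiltonian_gt0 b2P l2P (a := a2)) => //; rewrite (dgF0 _).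
  have := i2 cl; rewrite mulN1r -(mul1r (- _)) => i2'.
  by have := penalized_gap_gt0 (n2 cl) i2' C0 Dneg; rewrite !(mulrN, mulNr) opprK.
have [_ _ cover _ _] := HO.
have : setT z'.1 by []; rewrite -cover => -[[zO|zO]|zS].
- have Dpos : 0 <= D z' by rewrite DE; exact: sdist_ge0.
  have := pos1 (subset_closure zO) Dpos.
  by rewrite ltNge sub1.
- have nO : ~ O1 z'.1.
    have [_ disj _ _ _] := HO => zO1.
    by have : (O1 `&` O2) z'.1 by []; rewrite disj.
  have Dneg : D z' <= 0 by rewrite DE; exact: sdist_le0.
  have := pos2 (subset_closure zO) Dneg.
  by rewrite ltNge sub2.
(* On the hypersurface [D z' = 0], so the signs required on both sides hold; both Hamiltonian
   expressions are positive, and so is their minimum. *)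
- have [c1 c2] := hypersurface_closure HO zS.
  have Dz'0 : D z' = 0 by rewrite DE; exact: sdist_in.
  rewrite Dz'0 lexx in pos1 pos2.
  by have := subS zS; rewrite addr_minr leNgt lt_min (pos1 c1 isT) (pos2 c2 isT).
Qed.

End Subsolution.

(** * Passage from strictly outward controls to regular ones *)

Section Perturbation.
Context {R : realType}.

(** Writing the perturbed inequalities as polynomials in [t] reduces the limit [t -> 0] to the
    continuity of polynomials. *)
Lemma horner_right_le0 (p : {poly R}) :
  (\forall t \near (0 : R)^'+, p.[t] <= 0) -> p.[0] <= 0.
Proof.
move=> ple; rewrite leNgt; apply/negP => p0.
have pc : {for (0 : R), continuous (horner p)} by exact: continuous_horner.
have pgt : \forall t \near (0 : R)^'+, 0 < p.[t].
  have : \forall t \near (0 : R), 0 < p.[t] by exact: (cvgr_gt _ pc _ p0).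
  by move=> H; apply: filterS H.
have [t [tle tgt]] := filter_ex (filterI ple pgt).
by rewrite leNgt tgt in tle.
Qed.

(* If [beta1 = beta2 = 0], the perturbations [t1 delta1] and [t2 delta2] are
   taken proportional to [1 - mu] and [mu] up to second order. *)
Lemma perturbed_combination (beta1 beta2 delta1 delta2 f1 f2 g1 g2 mu : R) :
  0 <= mu <= 1 -> 0 <= beta1 -> 0 <= beta2 -> 0 < delta1 -> 0 < delta2 ->
  mu * beta1 = (1 - mu) * beta2 ->
  (forall t1 t2 : R, 0 < t1 < 1 -> 0 < t2 < 1 ->
    (t2 * delta2 + (1 - t2) * beta2) * (t1 * g1 + (1 - t1) * f1) +
    (t1 * delta1 + (1 - t1) * beta1) * (t2 * g2 + (1 - t2) * f2) <= 0) ->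
  mu * f1 + (1 - mu) * f2 <= 0.
Proof.
have polyE := (hornerD, hornerN, hornerM, hornerX, hornerC, hornerXn).
move=> /andP[mu0 mu1] beta1_ge0 beta2_ge0 delta1_gt0 delta2_gt0 balance H.
have [b0|bN0] := eqVneq (beta1 + beta2) 0; last first.
  have b_gt0 : 0 < beta1 + beta2 by rewrite lt_neqAle eq_sym bN0 addr_ge0.
  pose p : {poly R} :=
    ('X * delta2%:P + (1%:P - 'X) * beta2%:P) * ('X * g1%:P + (1%:P - 'X) * f1%:P) +
    ('X * delta1%:P + (1%:P - 'X) * beta1%:P) * ('X * g2%:P + (1%:P - 'X) * f2%:P).
  have : p.[0] <= 0.
    apply: horner_right_le0; near=> t.
    have t01 : 0 < t < 1.
      by apply/andP; split; near: t; [exact: nbhs_right_gt|exact: nbhs_right_lt].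
    by rewrite /p !polyE; exact: H.
  rewrite /p !polyE => h; rewrite -(pmulr_lle0 _ b_gt0).
  (* The right-hand side is [(beta1 + beta2) * (mu * f1 + (1 - mu) * f2)]; its last term vanishes by
     [balance]. *)
  rewrite [leLHS](_ : _ = beta2 * f1 + beta1 * f2 +
    (mu * beta1 - (1 - mu) * beta2) * (f1 - f2)); last by ring.
  by rewrite balance subrr mul0r addr0; lra.
move/eqP: b0; rewrite paddr_eq0// => /andP[/eqP b10 /eqP b20].
(* This is the hypothesis at [t1 = (t * (1 - mu) + t * t) / delta1] and
   [t2 = (t * mu + t * t) / delta2], divided by [t]. The square keeps [t1] and [t2] positive when
   [mu] is 0 or 1, and [p.[0]] is the desired combination. *)
pose p : {poly R} :=
  (mu%:P + 'X) * (('X * (1 - mu)%:P + 'X ^+ 2) * (g1 / delta1)%:P +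
    (1%:P - ('X * (1 - mu)%:P + 'X ^+ 2) * (delta1^-1)%:P) * f1%:P) +
  ((1 - mu)%:P + 'X) * (('X * mu%:P + 'X ^+ 2) * (g2 / delta2)%:P +
    (1%:P - ('X * mu%:P + 'X ^+ 2) * (delta2^-1)%:P) * f2%:P).
have : p.[0] <= 0.
  apply: horner_right_le0; near=> t.
  have t0 : 0 < t by near: t; exact: nbhs_right_gt.
  have t1 : t < 1 by near: t; exact: nbhs_right_lt.
  have td1 : t < delta1 / 2 by near: t; apply: nbhs_right_lt; exact: divr_gt0.
  have td2 : t < delta2 / 2 by near: t; apply: nbhs_right_lt; exact: divr_gt0.
  have tt : t * t <= t by rewrite ler_piMr// ltW.
  have tt0 : 0 < t * t by exact: mulr_gt0.
  have tmu0 : 0 <= t * mu by rewrite mulr_ge0// ltW.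
  have tmu1 : 0 <= t * (1 - mu) by rewrite mulr_ge0 ?subr_ge0// ltW.
  have h1 : 0 < (t * (1 - mu) + t * t) / delta1 < 1.
    by rewrite divr_gt0 ?ltr_pdivrMr//= ?mul1r; lra.
  have h2 : 0 < (t * mu + t * t) / delta2 < 1.
    by rewrite divr_gt0 ?ltr_pdivrMr//= ?mul1r; lra.
  have h := H _ _ h1 h2; rewrite b10 b20 in h.
  rewrite /p !polyE -(pmulr_lle0 _ t0).
  apply: le_trans h; rewrite le_eqVlt; apply/orP; left; apply/eqP.
  by field; rewrite !gt_eqF.
by rewrite /p !polyE; apply: le_trans; rewrite le_eqVlt; apply/orP; left;
  apply/eqP; ring.
Unshelve. all: by end_near. Qed.

End Perturbation.

Section Convexity.
Context {R : realType} {N : nat} {A : metricType R}.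
Local Notation V := 'rV[R]_N.

(** Convexity in (C3) bears on the pairs of drift and cost, so a single control realizes both
    combinations. *)
Lemma control_mix (U : set V) (T : R) (b : V -> R -> A -> V)
    (l : V -> R -> A -> R) x s a e (t : R) :
  hypC3 U T b l -> closure U x -> 0 <= s <= T -> 0 < t < 1 ->
  exists c, b x s c = t *: b x s e + (1 - t) *: b x s a /\
            l x s c = t * l x s e + (1 - t) * l x s a.
Proof.
move=> bl Ux sT /andP[t0 t1]; have [_ conv] := bl x s Ux sT.
have [|||c _ E] := conv (b x s e, l x s e) (b x s a, l x s a) t.
- by exists e.
- by exists a.
- by rewrite !ltW.
by exists c; split; [exact: (congr1 fst E)|exact: (congr1 snd E)].
Qed.

End Convexity.

(** * The tangential inequality *)

Section TangentialGradient.
Context {R : realType} {N : nat}.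
Local Notation V := 'rV[R]_N.
Local Notation W := (V * R)%type.
Variables (O1 O2 S : set V) (T : R).
Hypothesis HO : HOmega O1 O2 S.
Implicit Types (z : W) (phi psi : W -> R) (v : V).

Local Notation d := (sdist O1 S).

Lemma is_derive_curve_time psi z v (g : R -> V) : C1_at psi z ->
  g 0 = z.1 -> is_derive (0 : R) (1 : R) g v ->
  is_derive (0 : R) (1 : R) (fun r => psi (g r, z.2)) (dot v (gradx psi z)).
Proof.
move=> psiC g0 gv; have dpsi := C1_at_differentiable psiC.
have dslice : differentiable (fun x => psi (x, z.2)) (g 0).
  apply: (@differentiable_comp _ _ _ _ (fun x : V => (x, z.2)) psi (g 0)).
    exact: differentiable_pair.
  by rewrite g0 -surjective_pairing.
have := is_derive_comp_curve dslice gv.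
rewrite -(deriveE _ dslice) g0 derive_fst (deriveE _ dpsi) diff_gradx_dt//.
by rewrite mul0r addr0.
Qed.

(** The orthogonal projection of [gradx psi z] on the tangent space satisfies the specification of
    [gradS], so [xget] does not return its default. Uniqueness of the derivative along a curve of
    velocity [v] then identifies the two products. *)
Lemma dot_gradS phi psi z v : S z.1 -> C1_at psi z ->
  (\forall y \near z, S y.1 -> phi y = psi y) ->
  dot v (grad d z.1) = 0 -> dot v (gradS S phi z) = dot v (gradx psi z).
Proof.
move=> Sz psiC phipsi vp.
pose p := grad d z.1; pose q := gradx psi z.
have p0 : p != 0 by exact: (grad_sdist_neq0 HO).
have along u g : curve_on S z.1 u g ->
    is_derive (0 : R) (1 : R) (fun r => phi (g r, z.2)) (dot u q).
  move=> [g0 gS gu]; apply: near_eq_is_derive (is_derive_curve_time psiC g0 gu).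
  have gd : differentiable g (0 : R) by apply/derivable1_diffP; case: gu.
  have gzc : {for (0 : R), continuous (fun r => (g r, z.2))}.
    exact/differentiable_continuous/differentiable_pair.
  rewrite /prop_for /continuous_at g0 -surjective_pairing in gzc.
  have nphi : \forall r \near (0 : R), S (g r) -> phi (g r, z.2) = psi (g r, z.2).
    exact: (gzc _ phipsi).
  by apply: filterS2 gS nphi => r gr /(_ gr).
pose t := q - (dot q p / dot p p) *: p.
have tp : dot t p = 0 by rewrite dotBl dotZl divfK ?subrr// gt_eqF// dot_gt0.
have tu u : dot u p = 0 -> dot t u = dot u q.
  by move=> up; rewrite dotBl dotZl (dotC p) up mulr0 subr0 dotC.
have [xT xd] : [set x | tangent_space S z.1 x /\ forall u g,
    curve_on S z.1 u g ->
    is_derive (0 : R) (1 : R) (fun r => phi (g r, z.2)) (dot x u)] (gradS S phi z).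
  apply: (xgetPex 0); exists t; split; first exact/(tangent_spaceP HO).
  move=> u g gu; rewrite tu; first exact: along.
  by apply/(tangent_spaceP HO) => //; exists g.
have [g gv] := (tangent_spaceP HO v Sz).2 vp.
have [_ e1] := xd _ _ gv; have [_ e2] := along _ _ gv.
by rewrite dotC -e1 -e2.
Qed.

End TangentialGradient.

Section Regular.
Context {R : realType} {N : nat} {A1 A2 : metricType R}.
Local Notation V := 'rV[R]_N.
Local Notation W := (V * R)%type.
Variables (O1 O2 S : set V) (n1 n2 : V -> V) (T : R).
Variables (b1 : V -> R -> A1 -> V) (l1 : V -> R -> A1 -> R).
Variables (b2 : V -> R -> A2 -> V) (l2 : V -> R -> A2 -> R).
Hypotheses (HO : HOmega O1 O2 S).
Hypotheses (n1P : forall z, S z -> outward_unit_normal O1 z (n1 z)).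
Hypotheses (n2P : forall z, S z -> outward_unit_normal O2 z (n2 z)).
Hypotheses (b1P : hypC1 O1 T b1) (b2P : hypC1 O2 T b2).
Hypotheses (l1P : hypC2 O1 T l1) (l2P : hypC2 O2 T l2).
Hypotheses (c1P : hypC3 O1 T b1 l1) (c2P : hypC3 O2 T b2 l2).
Hypothesis controllable : hypC4 S n1 n2 T b1 b2.
Implicit Types (z : W) (w phi psi : W -> R).

Local Notation d := (sdist O1 S).

(** Drifts without normal component exist by (C4). Nonemptiness is what allows a supremum to be
    bounded through its elements. *)
Lemma A0reg_neq0 z : S z.1 -> open_cylinder T z ->
  A0reg n1 n2 b1 b2 z !=set0.
Proof.
move=> Sz zT; have [delta d0 ctl] := controllable.
have d00 : - delta <= 0 <= delta by lra.
have [[a1 a1E] [a2 a2E]] := ctl _ _ Sz (open_cylinderW zT) 0 d00.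
exists (a1, a2, 1); split => /=.
- by rewrite ler01 lexx.
- by rewrite /bS /= subrr scale0r addr0 scale1r.
- by rewrite a1E.
- by rewrite a2E.
Qed.

(** Each control of [a] is mixed, with weight [t_i], with a control [e_i] of normal speed [delta].
    The mixtures are strictly outward, so [weighted_gap_le0] applies to them, and
    [perturbed_combination] removes the weights. *)
Lemma regular_control_gap w psi z a :
  visc_sub O1 O2 S T b1 l1 b2 l2 w ->
  S z.1 -> open_cylinder T z ->
  (\forall y \near z, C1_at psi y) ->
  (\forall y \near z, S y.1 -> w y - psi y <= w z - psi z) ->
  A0reg n1 n2 b1 b2 z a ->
  dot (bS b1 b2 z a) (grad d z.1) = 0 /\
  dt psi z + (- dot (bS b1 b2 z a) (gradx psi z) - lS l1 l2 z a) <= 0.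
Proof.
move=> wsub Sz zT psiC wmax [mu01 an a1n a2n].
have psiz := C1_at_differentiable (nbhs_singleton psiC).
have [k1 k10 n1E] := normal1 HO Sz (n1P Sz).
have [k2 k20 n2E] := normal2 HO Sz (n2P Sz).
have zT' := open_cylinderW zT.
have [cl1 cl2] := hypersurface_closure HO Sz.
case: a mu01 an a1n a2n => [[a1 a2] mu] /= mu01 an a1n a2n.
set p := grad d z.1 in n1E n2E *.
have bp : dot (bS b1 b2 z (a1, a2, mu)) p = 0.
  move: an; rewrite n1E dotZr => /eqP; rewrite mulf_eq0 oppr_eq0 gt_eqF//=.
  by move/eqP.
split=> //.
rewrite n1E dotZr mulNr -mulrN pmulr_rge0// in a1n.
rewrite n2E dotZr pmulr_rge0// in a2n.
have [delta d0 ctl] := controllable.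
have dd : - delta <= delta <= delta by lra.
have [[e1 e1E] [e2 e2E]] := ctl _ _ Sz zT' delta dd.
have e1p : 0 < - dot (b1 z.1 z.2 e1) p.
  by move: d0; rewrite -e1E n1E dotZr mulNr -mulrN pmulr_rgt0.
have e2p : 0 < dot (b2 z.1 z.2 e2) p.
  by move: d0; rewrite -e2E n2E dotZr pmulr_rgt0.
pose f1 a := dt psi z - dot (b1 z.1 z.2 a) (gradx psi z) - l1 z.1 z.2 a.
pose f2 a := dt psi z - dot (b2 z.1 z.2 a) (gradx psi z) - l2 z.1 z.2 a.
have balance : mu * (- dot (b1 z.1 z.2 a1) p) = (1 - mu) * dot (b2 z.1 z.2 a2) p.
  by move: bp; rewrite /bS /= dotDl !dotZl; lra.
have : mu * f1 a1 + (1 - mu) * f2 a2 <= 0.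
  apply: (perturbed_combination (g1 := f1 e1) (g2 := f2 e2) mu01 a1n a2n e1p e2p
    balance) => t1 t2 t1P t2P.
  have [c1 [b1E l1E]] := control_mix a1 e1 c1P cl1 zT' t1P.
  have [c2 [b2E l2E]] := control_mix a2 e2 c2P cl2 zT' t2P.
  have beta1E : - dot (b1 z.1 z.2 c1) p =
      t1 * - dot (b1 z.1 z.2 e1) p + (1 - t1) * - dot (b1 z.1 z.2 a1) p.
    by rewrite b1E dotDl !dotZl; ring.
  have beta2E : dot (b2 z.1 z.2 c2) p =
      t2 * dot (b2 z.1 z.2 e2) p + (1 - t2) * dot (b2 z.1 z.2 a2) p.
    by rewrite b2E dotDl !dotZl.
  have f1E : f1 c1 = t1 * f1 e1 + (1 - t1) * f1 a1.
    by rewrite /f1 b1E l1E dotDl !dotZl; ring.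
  have f2E : f2 c2 = t2 * f2 e2 + (1 - t2) * f2 a2.
    by rewrite /f2 b2E l2E dotDl !dotZl; ring.
  move/andP: t1P => [t10 t11]; move/andP: t2P => [t20 t21].
  have beta1_gt0 : 0 < - dot (b1 z.1 z.2 c1) p.
    rewrite beta1E ltr_pwDl//; first exact: mulr_gt0.
    by rewrite mulr_ge0// subr_ge0 ltW.
  have beta2_gt0 : 0 < dot (b2 z.1 z.2 c2) p.
    rewrite beta2E ltr_pwDl//; first exact: mulr_gt0.
    by rewrite mulr_ge0// subr_ge0 ltW.
  have := weighted_gap_le0 HO b1P b2P l1P l2P wsub Sz zT psiC wmax
    beta1_gt0 beta2_gt0.
  rewrite !diff_gradx_dt// !dotNl !mul1r -beta1E -beta2E -f1E -f2E /f1 /f2.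
  by rewrite !(addrC (- dot _ _)).
apply: le_trans; rewrite /bS /lS /f1 /f2 /= dotDl !dotZl.
by rewrite le_eqVlt; apply/orP; left; apply/eqP; ring.
Qed.

(** A local C1 extension [psi] replaces the test function: the time derivative and the tangential
    gradient only see values on the hypersurface, and regular drifts are tangential. *)
Lemma visc_sub_regP w : visc_sub O1 O2 S T b1 l1 b2 l2 w ->
  visc_sub_reg S n1 n2 T b1 l1 b2 l2 w.
Proof.
move=> wsub phi phiC z Sz zT wmax.
have [U [psi [oU Uz psiC phipsi]]] := phiC z Sz (open_cylinderW zT).
have nU := open_nbhs_nbhs (conj oU Uz).
have nT := open_cylinder_near zT.
have psiCn : \forall y \near z, C1_at psi y.
  by apply: filterS nU => y Uy; exact: C1_on_at psiC.
have phipsin : \forall y \near z, S y.1 -> phi y = psi y.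
  apply: filterS2 nU nT => y Uy /open_cylinderW yT Sy; exact: phipsi.
have psiz : phi z = psi z by exact: (nbhs_singleton phipsin).
have wmaxn : \forall y \near z, S y.1 -> w y - psi y <= w z - psi z.
  apply: filterS2 phipsin nT => y ye yT Sy.
  by rewrite -ye// -psiz; exact: wmax.
have dtE : dt phi z = dt psi z.
  rewrite /dt !derive1E; apply: near_eq_derive.
  have c : {for z.2, continuous (fun s : R => (z.1, s))}.
    exact/differentiable_continuous/differentiable_pair.
  rewrite /prop_for /continuous_at -surjective_pairing in c.
  have nz : \forall s \near z.2, S z.1 -> phi (z.1, s) = psi (z.1, s).
    exact: (c _ phipsin).
  by apply: filterS nz => s /(_ Sz).
rewrite -lerBrDl sub0r dtE; apply: ge_sup.
  by have [a aP] := A0reg_neq0 Sz zT; exists (- dot (bS b1 b2 z a)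
    (gradS S phi z) - lS l1 l2 z a), a.
move=> _ [a aP <-].
have [bp gap] := regular_control_gap wsub Sz zT psiCn wmaxn aP.
rewrite (dot_gradS HO Sz (nbhs_singleton psiCn) phipsin bp); lra.
Qed.

End Regular.

Theorem theorem3p6 (R : realType) (N : nat)
    (O1 O2 S : set 'rV[R]_N) (n1 n2 : 'rV[R]_N -> 'rV[R]_N)
    (T : R) (A1 A2 : metricType R)
    (b1 : 'rV[R]_N -> R -> A1 -> 'rV[R]_N) (l1 : 'rV[R]_N -> R -> A1 -> R)
    (b2 : 'rV[R]_N -> R -> A2 -> 'rV[R]_N) (l2 : 'rV[R]_N -> R -> A2 -> R)
    (u : 'rV[R]_N * R -> R) :
  HOmega O1 O2 S ->
  (forall z, S z -> outward_unit_normal O1 z (n1 z)) ->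
  (forall z, S z -> outward_unit_normal O2 z (n2 z)) ->
  0 < T ->
  hypC1 O1 T b1 -> hypC1 O2 T b2 ->
  hypC2 O1 T l1 -> hypC2 O2 T l2 ->
  hypC3 O1 T b1 l1 -> hypC3 O2 T b2 l2 ->
  hypC4 S n1 n2 T b1 b2 ->
  bounded_cyl T u ->
  subsolution_H O1 O2 S T b1 l1 b2 l2 u ->
  subsolution_Hplus O1 O2 S n1 n2 T b1 l1 b2 l2 u.
Proof.
move=> HO n1P n2P _ b1P b2P l1P l2P c1P c2P c4 _ usub.
split; first exact: usub.
exact: (visc_sub_regP HO n1P n2P b1P b2P l1P l2P c1P c2P c4 usub).
Qed.
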